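(* Let $W=\langle s,t: s^2=t^2=(st)^m=1\rangle$ be a Coxeter group of rank $2$ with $S=\{s,t\}$, $m\ge 2$ the order of $st$, and $w_0$ its longest element. Then $\Phi_S=\operatorname{Ind}_{\langle w_0\rangle}^W(1)-1_S$ and $\Psi_S=\pi_{\mathcal A}-1_S=\Phi_S\epsilon_S$. Moreover, the cuspidal conjugacy classes of $W$ are represented by $(st)^j$, $j=1,\dots,\lfloor m/2\rfloor$, and with $\varphi_{(st)^j}=\chi_j$ if $m$ is odd, and $\varphi_{(st)^j}=\chi_{2j}$ for $0<j<m/2$, $\varphi_{w_0}=\epsilon_S$ if $m$ is even, and $\psi_{(st)^j}=\varphi_{(st)^j}\epsilon$, these are linear characters of $C_W((st)^j)$ satisfying $\Phi_S=\sum_{j}\operatorname{Ind}_{C_W((st)^j)}^W\varphi_{(st)^j}$ and $\Psi_S=\sum_j\operatorname{Ind}_{C_W((st)^j)}^W\psi_{(st)^j}$ (sums over $j=1,\dots,\lfloor m/2\rfloor$).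
   Context: $1_S,\epsilon_S$ are the trivial and sign characters of $W$ ($\epsilon$ also denotes restrictions of $\epsilon_S$). $W^+=\langle st\rangle$; for a fixed primitive $m$-th root of unity $\zeta_m$, $\chi_j$ is the linear character of $W^+$ with $\chi_j(st)=\zeta_m^j$. $\pi_{\mathcal A}$ is the permutation character of $W$ on the set $\mathcal A$ of reflecting hyperplanes. $\Phi_S$ is the character of $W$ on $e_S\mathbb CW$ (right multiplication), where: for $J\subseteq S$, $X_J=\{w:\ell(rw)>\ell(w)\ \forall r\in J\}$, $x_J=\sum_{x\in X_J}x^{-1}$, $X_J^\sharp=\{x\in X_J:x^{-1}Jx\subseteq S\}$, $m_{KL}=|X_K\cap X_L^\sharp|$ if $L\subseteq K$ and $0$ otherwise, and $e_L$ is defined by $x_K=\sum_Lm_{KL}e_L$. $\Psi_S$ is the character of $W$ on the degree $2$ component of the Orlik–Solomon algebra $A(W)$ (generated by $a_t$, $t$ a reflection, with $a_ta_{t'}=-a_{t'}a_t$ and $\sum_{i=1}^p(-1)^ia_{t_1}\cdots\widehat{a_{t_i}}\cdots a_{t_p}=0$ for linearly dependent $\{H_{t_i}\}$; $W$ acts by $a_t.w=a_{w^{-1}tw}$). An element is cuspidal if it has no nonzero fixed vector in the reflection representation. *)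

(* Defs.v *)
From HB Require Import structures.
From mathcomp Require Import all_boot all_order all_algebra all_fingroup.
From mathcomp Require Import all_solvable all_field all_character.
Set Implicit Arguments. Unset Strict Implicit. Unset Printing Implicit Defensive.
Import Order.TTheory GRing.Theory Num.Theory.
Local Open Scope ring_scope.

(* trace of R restricted to the (R-invariant) row space U *)
Definition restr_trace (n : nat) (U R : 'M[algC]_n) : algC :=
  \tr (row_base U *m R *m pinvmx (row_base U)).

(* trace of the map induced by R on the quotient V/U (U <= V, both R-invariant):
   C is a complement of U in V, and c |-> (c R projected on C along U). *)
Definition quot_trace (n : nat) (V U R : 'M[algC]_n) : algC :=
  let C := (V :\: U)%MS in
  \tr (row_base C *m R *m proj_mx C U *m pinvmx (row_base C)).

Section Coxeter.
Variables (gT : finGroupType) (s t : gT).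

Definition Sset : {set gT} := [set s; t].

Fixpoint words (n : nat) : {set gT} :=
  if n is n'.+1 then (Sset * words n')%g else [set 1%g]%g.

(* Coxeter length l(w): least n with w a product of n elements of S
   (the search bound #|gT| exceeds the length of any element of <S>). *)
Definition clen (w : gT) : nat :=
  find (fun n => w \in words n) (iota 0 #|gT|.+1).

Definition sgnS (w : gT) : algC := (-1) ^+ clen w.

Definition longest (W : {set gT}) : gT := [arg max_(w > 1%g in W) clen w].

Variable W : {set gT}.

Definition Xset (J : {set gT}) : {set gT} :=
  [set w in W | [forall r in J, (clen w < clen (r * w)%g)%N]].
Definition Xsharp (J : {set gT}) : {set gT} :=
  [set x in Xset J | (J :^ x)%g \subset Sset].
Definition mKL (K L : {set gT}) : nat :=
  if L \subset K then #|Xset K :&: Xsharp L| else 0.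

(* group algebra CW: row vectors indexed by gT (supported on W) *)
Definition gel (g : gT) : 'rV[algC]_#|gT| := delta_mx 0 (enum_rank g).
Definition gmul (a b : 'rV[algC]_#|gT|) : 'rV[algC]_#|gT| :=
  \row_k \sum_i \sum_(j | (enum_val i * enum_val j == enum_val k)%g) a 0 i * b 0 j.

Definition xK (K : {set gT}) : 'rV[algC]_#|gT| := \sum_(x in Xset K) gel x^-1.

(* e_K by solving the unitriangular system x_K = sum_{L <= K} m_KL e_L
   (recursion on proper subsets, fuel = #|K|) *)
Fixpoint eaux (k : nat) (K : {set gT}) : 'rV[algC]_#|gT| :=
  ((mKL K K)%:R)^-1 *:
    (xK K - match k with
            | 0 => 0
            | k'.+1 => \sum_(L : {set gT} | L \proper K) (mKL K L)%:R *: eaux k' L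
            end).
Definition eL (K : {set gT}) : 'rV[algC]_#|gT| := eaux #|K| K.

Definition Rg (w : gT) : 'M[algC]_#|gT| :=
  \matrix_(i, j) ((enum_val j == enum_val i * w)%g)%:R.

Definition eSCW : 'M[algC]_#|gT| := (\sum_(g in W) <<gmul (eL Sset) (gel g)>>)%MS.

Definition Phi_S (w : gT) : algC := restr_trace eSCW (Rg w).

Variable rho : gT -> 'M[algC]_2.

Definition refls : {set gT} := ((s ^: W) :|: (t ^: W))%g.

(* reflecting hyperplane of r (fixed row vectors), in canonical form *)
Definition hyp (r : gT) : 'M[algC]_2 := <<kermx (rho r - 1%:M)>>%MS.
Definition hyps : seq 'M[algC]_2 := undup [seq hyp r | r <- enum refls].

Definition piA (w : gT) : algC :=
  (count (fun H => <<H *m rho w>>%MS == H) hyps)%:R.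

(* {H_{t_1},...,H_{t_p}} linearly dependent: their defining linear forms
   (spanning the column spaces of rho t_i - 1) are linearly dependent *)
Definition hdep (ts : seq gT) : bool :=
  (\rank (\sum_(r <- ts) <<(rho r - 1%:M)^T>>)%MS < size ts)%N.

(* exterior square: antisymmetric functions on gT * gT *)
Definition pvec (p : gT * gT) : 'rV[algC]_#|{: gT * gT}| := delta_mx 0 (enum_rank p).
Definition wedge (x y : gT) := pvec (x, y) - pvec (y, x).

Definition Lam2 : 'M[algC]_#|{: gT * gT}| :=
  (\sum_(x in refls) \sum_(y in refls) <<wedge x y>>)%MS.

(* degree-2 part of the Orlik-Solomon ideal: generated by
   r_D = sum_i (-1)^i a_{t_1}..^{a_{t_i}}..a_{t_p} for dependent D, p = 3, 2, 1 *)
Definition OSrel : 'M[algC]_#|{: gT * gT}| :=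
  ((\sum_(x in refls) \sum_(y in refls) \sum_(z in refls | hdep [:: x; y; z])
      <<wedge x z - wedge y z - wedge x y>>)
   + (\sum_(u in refls) \sum_(x in refls) \sum_(y in refls | hdep [:: x; y])
      <<wedge u x - wedge u y>>)
   + (\sum_(u in refls) \sum_(v in refls) \sum_(x in refls | hdep [:: x])
      <<- wedge u v>>))%MS.

Definition Rp (w : gT) : 'M[algC]_#|{: gT * gT}| :=
  \matrix_(i, j) ((enum_val j == (((enum_val i).1 ^ w)%g, ((enum_val i).2 ^ w)%g)))%:R.

Definition Psi_S (w : gT) : algC := quot_trace Lam2 OSrel (Rp w).

Definition cuspidal (w : gT) : bool := (\rank (kermx (rho w - 1%:M)) == 0)%N.

End Coxeter.

Section Chars.
Variables (gT : finGroupType) (s t : gT) (m : nat) (z : algC).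

Definition chi (j : nat) (x : gT) : algC :=
  z ^+ (j * odflt 0%N (omap val [pick k : 'I_m | ((s * t) ^+ k)%g == x]))%N.

Definition phi (j : nat) (x : gT) : algC :=
  if odd m then chi j x
  else if j.*2 == m then sgnS s t x else chi j.*2 x.

Definition psi (j : nat) (x : gT) : algC := phi j x * sgnS s t x.
End Chars.

(* Main.v *)
(** Write [r = s t].  Every element of [W] is an alternating word in [s] and
    [t], which gives the length function and [e_S = (1 + w_0) / 2 - (sum W) / 2m].
    This is an idempotent, so [Phi_S w] is the trace of [x |-> e_S x w], that is
    the sum of the coefficients of [e_S] at the conjugates of [w]; this is the
    induced character minus [1].  A rotation has determinant [1] and finite
    order, so it fixes no nonzero vector unless it is trivial.  Hence distinct
    reflections have distinct hyperplanes, any three of which are dependent, and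
    the degree [2] part of the Orlik-Solomon algebra is the quotient of the
    exterior square by all relations [a_y a_z - a_x a_z + a_x a_y]; an explicit
    equivariant projection computes [Psi_S w] as the number of reflections
    commuting with [w], minus [1].  All characters then take the value
    [m [w^2 = 1] - 1] on rotations and [0] or [+-1] on reflections, and the sums
    of induced characters reduce to sums of roots of unity. *)
Require Import Defs.
From mathcomp Require Import all_boot all_order all_algebra all_fingroup.
From mathcomp Require Import all_solvable all_field all_character.
From mathcomp Require Import zify ring.

Set Implicit Arguments.
Unset Strict Implicit.
Unset Printing Implicit Defensive.

Import Order.TTheory GRing.Theory Num.Theory.
Local Open Scope ring_scope.

(** * Traces on subspaces and quotients, computed by idempotents *)

(** With [B] a basis of [U] and [D = P *m pinvmx B], the idempotent factors as [P = D *m B] with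
    [B *m D = 1]. Cyclicity of the trace then moves [D] to the front. *)
Lemma restr_trace_idem n (U P R : 'M[algC]_n) :
    (U :=: P)%MS -> P *m P = P -> P *m R *m P = P *m R ->
  restr_trace U R = \tr (P *m R).
Proof.
move=> eqUP idP PR; rewrite /restr_trace.
set B := row_base U.
have eqBP : (B :=: P)%MS by exact: eqmx_trans (eq_row_base U) eqUP.
have fixP k (A : 'M_(k, n)) : (A <= P)%MS -> A *m P = A.
  by case/submxP=> D ->; rewrite -mulmxA idP.
have defP : P *m pinvmx B *m B = P by rewrite mulmxKpV // eqBP.
have BD : B *m (P *m pinvmx B) = 1%:M.
  apply: (row_free_inj (row_base_free U)).
  by rewrite mul1mx -mulmxA defP fixP // eqBP.
have BRP : (B *m R <= P)%MS.
  have /submxP[D ->] : (B <= P)%MS by rewrite eqBP.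
  by rewrite -mulmxA -PR mulmxA submxMl.
have defBR : B *m R *m pinvmx B *m B = B *m R by rewrite mulmxKpV // eqBP.
rewrite -[B *m R *m pinvmx B]mulmx1 -BD mulmxA defBR.
by rewrite mxtrace_mulC mulmxA defP.
Qed.

Lemma submx_subr (F : fieldType) m1 m2 n (A B : 'M[F]_(m1, n)) (C : 'M_(m2, n)) :
  (A <= C)%MS -> (B <= C)%MS -> (A - B <= C)%MS.
Proof. by move=> AC BC; rewrite addmx_sub // eqmx_opp. Qed.

(* [Q] is a projection of [V] onto a complement of [U], which need not be the
   complement chosen by [quot_trace]. *)
Lemma quot_trace_idem n (V U Q R : 'M[algC]_n) :
    (U <= V)%MS -> (U *m R <= U)%MS -> (V *m R <= V)%MS ->
    (Q <= V)%MS -> U *m Q = 0 -> (V *m (1%:M - Q) <= U)%MS -> Q *m Q = Q ->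
  quot_trace V U R = \tr (Q *m R).
Proof.
move=> sUV UR VR sQV UQ VQ idQ; rewrite /quot_trace.
set C := (V :\: U)%MS; set B := row_base C; set p := proj_mx C U.
have CU0 : (C :&: U)%MS = 0 by exact: capmx_diff.
have CUV : (C + U :=: V)%MS.
  apply: eqmx_trans (addsmx_diff_cap_eq V U).
  by apply: adds_eqmx => //; apply: eqmx_sym; apply/capmx_idPr.
have pU k (A : 'M_(k, n)) : (A <= U)%MS -> A *m p = 0.
  by move=> AU; apply: proj_mx_0.
have subp k (A : 'M_(k, n)) : (A <= V)%MS -> (A - A *m p <= U)%MS.
  by move=> AV; apply: proj_mx_compl_sub; rewrite CUV.
have UQ0 k (A : 'M_(k, n)) : (A <= U)%MS -> A *m Q = 0.
  by case/submxP=> D ->; rewrite -mulmxA UQ mulmx0.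
have URs k (A : 'M_(k, n)) : (A <= U)%MS -> (A *m R <= U)%MS.
  by move=> AU; apply: submx_trans UR; apply: submxMr.
have VRs k (A : 'M_(k, n)) : (A <= V)%MS -> (A *m R <= V)%MS.
  by move=> AU; apply: submx_trans VR; apply: submxMr.
have BC : (B :=: C)%MS := eq_row_base C.
have BV : (B <= V)%MS by rewrite BC diffmxSl.
have pB k (A : 'M_(k, n)) : A *m p *m pinvmx B *m B = A *m p.
  by rewrite mulmxKpV // BC proj_mx_sub.
have Bp : B *m p = B by rewrite proj_mx_id // BC.
(* [B *m (1 - Q)] lies in [U], which [p] kills. So [Q] followed by [p] is the identity on [C], and
   this identifies the two complements of [U]. *)
have BQp : B *m Q *m p = B.
  apply/esym/eqP; rewrite -subr_eq0 -{1}Bp -mulmxBl; apply/eqP/pU.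
  rewrite -{1}[B]mulmx1 -mulmxBr; apply: submx_trans VQ; exact: submxMr.
have BD : B *m (Q *m p *m pinvmx B) = 1%:M.
  apply: (row_free_inj (row_base_free C)).
  by rewrite mul1mx -mulmxA pB mulmxA.
rewrite -[B *m R *m p *m _]mulmx1 -BD mulmxA pB mxtrace_mulC.
have -> : Q *m p *m pinvmx B *m (B *m R *m p) = Q *m R *m p.
  rewrite -(mulmxA B R) (mulmxA _ B) pB (mulmxA _ R p); apply/esym/eqP; rewrite -subr_eq0 -!mulmxBl.
  by apply/eqP/pU/URs/subp.
rewrite -{1}idQ -(mulmxA Q Q) -(mulmxA Q) mxtrace_mulC.
have -> : Q *m R *m p *m Q = Q *m R *m Q.
  apply/esym/eqP; rewrite -subr_eq0 -mulmxBl.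
  by apply/eqP/UQ0/subp/VRs.
by rewrite mxtrace_mulC mulmxA idQ.
Qed.

(** * Matrices of size two *)

Lemma mxtrace2 (F : comNzRingType) (A : 'M[F]_2) : \tr A = A 0 0 + A 1 1.
Proof. by rewrite /mxtrace !big_ord_recl big_ord0 addr0; congr (A _ _ + A _ _); apply/val_inj. Qed.

Lemma det_mx22 (F : comNzRingType) (A : 'M[F]_2) :
  \det A = A 0 0 * A 1 1 - A 0 1 * A 1 0.
Proof.
rewrite (expand_det_row _ 0) !big_ord_recl big_ord0 /cofactor !det_mx11 !mxE /=.
rewrite addr0 expr0 mul1r expr1 mulN1r mulrN.
by congr (A _ _ * A _ _ - A _ _ * A _ _); apply/val_inj.
Qed.

Lemma det_sub1_2 (F : comNzRingType) (A : 'M[F]_2) :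
  \det (A - 1%:M) = 1 - \tr A + \det A.
Proof. by rewrite mxtrace2 !det_mx22 !mxE /=; ring. Qed.

(** Cayley-Hamilton in dimension two, checked entry by entry. *)
Lemma sqr_mx2 (F : comNzRingType) (A : 'M[F]_2) :
  A *m A = \tr A *: A - (\det A)%:M.
Proof.
apply/matrixP=> i j; rewrite mxtrace2 det_mx22 !mxE !big_ord_recl big_ord0.
have -> : lift ord0 ord0 = 1 :> 'I_2 by apply/val_inj.
case: i => [[|[|//]] hi]; case: j => [[|[|//]] hj]; rewrite /= ?mulr1n ?mulr0n.
- have -> : Ordinal hi = 0 by apply/val_inj.
  have -> : Ordinal hj = 0 by apply/val_inj.
  ring.
- have -> : Ordinal hi = 0 by apply/val_inj.
  have -> : Ordinal hj = 1 by apply/val_inj.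
  ring.
- have -> : Ordinal hi = 1 by apply/val_inj.
  have -> : Ordinal hj = 0 by apply/val_inj.
  ring.
- have -> : Ordinal hi = 1 by apply/val_inj.
  have -> : Ordinal hj = 1 by apply/val_inj.
  ring.
Qed.

(* [(A - 1) ^+ 2 = 0] by Cayley-Hamilton, so that [A ^+ n = 1 + (A - 1) *+ n]. *)
Lemma finite_order_mx2 (A : 'M[algC]_2) n :
  (0 < n)%N -> A ^+ n = 1 -> \det A = 1 -> \det (A - 1%:M) = 0 -> A = 1.
Proof.
move=> n0 An dA dA1.
have tA : \tr A = 2.
  by move: dA1; rewrite det_sub1_2 dA => /eqP; rewrite addrAC subr_eq0 => /eqP <-.
have A2 : (A - 1) * (A - 1) = 0.
  have := sqr_mx2 A; rewrite tA dA -[A *m A]/(A * A) => AA.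
  rewrite mulrBl mulrBr mul1r mulr1 AA scaler_nat mulr2n.
  by rewrite -[1%:M]/(1 : 'M_2) (addrAC (A + A)) addrK subrr.
have AX k : A ^+ k = 1 + (A - 1) *+ k.
  elim: k => [|k IH]; first by rewrite mulr0n addr0.
  rewrite exprSr IH -{2}[A](subrK 1) [_ - 1 + 1]addrC mulrDr mulr1 mulrDl mul1r.
  by rewrite mulrnAl A2 mul0rn addr0 -addrA -mulrSr.
move: An; rewrite AX => /eqP; rewrite addrC -subr_eq0 addrK -scaler_nat scaler_eq0.
by rewrite pnatr_eq0 eqn0Ngt n0 /= => /eqP/(congr1 (+%R^~ 1)); rewrite subrK add0r.
Qed.

(** * Delta sums, linear characters and sums of roots of unity *)

Lemma sum_deltaM (R : nzRingType) (T : finType) (P : pred T) (x : T) (F : T -> R) :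
  \sum_(y | P y) (y == x)%:R * F y = (P x)%:R * F x.
Proof.
rewrite big_mkcond (bigD1 x) //= eqxx big1 ?addr0 => [|y /negPf->].
  by case: (P x); rewrite ?mul0r.
by rewrite mul0r if_same.
Qed.

Lemma sum_delta (R : nzRingType) (T : finType) (P : pred T) (x : T) :
  \sum_(y | P y) (y == x)%:R = (P x)%:R :> R.
Proof.
have := @sum_deltaM R T P x (fun=> 1); rewrite mulr1 => <-.
by apply: eq_bigr => y _; rewrite mulr1.
Qed.

(* The junk value of [lin_of G F], when [F] is not a linear character on [G],
   is the principal character. *)
Definition lin_of (gT : finGroupType) (G : {group gT}) (F : gT -> algC) : 'CF(G) :=
  'chi_(odflt 0 [pick i : Iirr G | [forall x in G, 'chi_i x == F x]]).

(** A multiplicative [F] is afforded by the representation [(F x)%:M] of degree one. Its character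
    is irreducible, so the search in [lin_of] succeeds. *)
Lemma lin_ofP (gT : finGroupType) (G : {group gT}) (F : gT -> algC) :
    F 1%g = 1 -> {in G &, {morph F : x y / (x * y)%g >-> x * y}} ->
  lin_of G F \is a linear_char /\ {in G, lin_of G F =1 F}.
Proof.
move=> F1 FM.
have reprF : mx_repr G (fun x => (F x)%:M : 'M[algC]_1).
  by split=> [|x y xG yG]; rewrite ?F1 // FM // scalar_mxM.
pose xi := cfRepr (MxRepresentation reprF).
have xiE : {in G, xi =1 F}.
  by move=> x xG; rewrite cfunE xG mulr1n /= mxtrace_scalar mulr1n.
have xi_lin : xi \is a linear_char.
  by apply/andP; split; [apply: cfRepr_char | rewrite xiE ?group1 // F1].
have /irrP[i xi_i] := lin_char_irr xi_lin.
have linE : {in G, lin_of G F =1 F}.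
  rewrite /lin_of; case: pickP => [j /forall_inP jF x xG|/(_ i)/negP[]] /=.
    exact/eqP/jF.
  by apply/forall_inP=> x xG; rewrite -xi_i xiE.
by split=> //; apply/andP; split; [apply: irr_char | rewrite linE ?group1 // F1].
Qed.

(** The geometric sum over [0 <= j < n] vanishes unless [y = 1]; the missing term [j = 0] accounts
    for the [- 1]. *)
Lemma sum_unity_root (n : nat) (y : algC) : (0 < n)%N -> y ^+ n = 1 ->
  \sum_(1 <= j < n) y ^+ j = n%:R * (y == 1)%:R - 1.
Proof.
move=> n0 yn; have [->|y1] := eqVneq y 1.
  under eq_bigr do rewrite expr1n.
  by rewrite sumr_const_nat mulr1 natrB.
apply/eqP; rewrite mulr0 sub0r -subr_eq0 opprK addrC.
rewrite -{1}(expr0 y) -big_ltn // big_mkord.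
have := subrX1 y n; rewrite yn subrr => /esym/eqP; rewrite mulf_eq0 subr_eq0.
by rewrite (negbTE y1).
Qed.

(** Serves to merge the contributions of the exponents [j] and [n - j] into a sum over one
    interval. *)
Lemma sum_nat_rev (V : nmodType) (G : nat -> V) h n : (h <= n)%N ->
  \sum_(1 <= j < h.+1) G (n - j)%N = \sum_(n - h <= i < n) G i.
Proof.
elim: h => [|h IHh] hn; first by rewrite subn0 !big_geq.
rewrite big_nat_recr //= IHh ?(ltnW hn) // [RHS]big_ltn; last lia.
by rewrite addrC; congr (_ + _); congr bigop; rewrite /index_iota; do 2?congr iota; lia.
Qed.

(** * Rotations and reflections in the dihedral group *)

Section Dihedral.

Variables (gT : finGroupType) (W : {group gT}) (s t : gT) (m : nat).
Hypotheses (m_gt1 : (1 < m)%N) (os : #[s]%g = 2%N) (ot : #[t]%g = 2%N).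
Hypotheses (or : #[(s * t)%g]%g = m) (defW : W :=: <<[set s; t]>>%g).

Local Notation r := (s * t)%g.
Local Notation rot := <[(s * t)%g]>%g.

Local Open Scope group_scope.

Lemma invol_mul (x : gT) : #[x] = 2%N -> x * x = 1.
Proof. by move=> ox; rewrite -expg2 -ox expg_order. Qed.

Let ss := invol_mul os.
Let tt := invol_mul ot.

Lemma mulKs x : s * (s * x) = x.
Proof. by rewrite mulgA ss mul1g. Qed.

Lemma mulsK x : x * s * s = x.
Proof. by rewrite -mulgA ss mulg1. Qed.

Lemma invs : s^-1 = s.
Proof. by apply/eqP; rewrite eq_invg_mul ss. Qed.

Lemma invt : t^-1 = t.
Proof. by apply/eqP; rewrite eq_invg_mul tt. Qed.

Lemma conj_rot_s x : x \in rot -> x ^ s = x^-1.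
Proof.
case/cycleP=> k ->; rewrite conjXg -expgVn; congr (_ ^+ k).
by rewrite conjgE invMg invs invt -(mulgA s t) mulKs.
Qed.

Lemma mul_s_rot x : x \in rot -> s * x = x^-1 * s.
Proof. by move=> /conj_rot_s <-; rewrite conjgE invs -mulgA mulsK. Qed.

Lemma mul_rot_s x : x \in rot -> x * s = s * x^-1.
Proof. by move=> xr; rewrite mul_s_rot ?groupV // invgK. Qed.

Lemma rot_comm x y : x \in rot -> y \in rot -> x * y = y * x.
Proof. by case/cycleP=> i -> /cycleP[j ->]; rewrite -!expgD addnC. Qed.

(** If [s] were a rotation it would both commute with [r] and invert it, so [r] would have square
    [1] and [rot] would be [{1, r}]. But [s = 1] contradicts the order of [s], and [s = r] gives
    [t = 1]. *)
Lemma s_notin_rot : s \notin rot.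
Proof.
apply/negP=> sr.
have rV : r^-1 = r by rewrite -conj_rot_s ?cycle_id // conjgE (rot_comm (cycle_id r) sr) mulKg.
have rr : r * r = 1 by rewrite -{1}rV mulVg.
have rot2 x : x \in rot -> x \in [set 1; r].
  case/cycleP=> k ->; rewrite -(odd_double_half k) expgD -mul2n expgM expg2 rr.
  by rewrite expg1n mulg1; case: odd; rewrite ?expg1 ?expg0 !inE eqxx ?orbT.
have := rot2 s sr; rewrite !inE => /orP[/eqP s1|/eqP srE]; first by move: os; rewrite s1 order1.
have t1 : t = 1 by apply: (mulgI s); rewrite mulg1 -srE.
by move: ot; rewrite t1 order1.
Qed.

Lemma W_mul : W :=: rot * <[s]>.
Proof.
have nrot : <[s]> \subset 'N(rot).
  rewrite cycle_subG inE; apply/subsetP=> x; case/imsetP=> y yr ->.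
  by rewrite conj_rot_s ?groupV.
rewrite -norm_joinEr // defW; apply/eqP; rewrite eqEsubset !gen_subG /=.
apply/andP; split; apply/subsetP=> x; rewrite inE.
- have sS : s \in rot <*> <[s]> by apply: (subsetP (joing_subr _ _)); apply: cycle_id.
  case/orP=> /set1P->//.
  suff : s * r \in rot <*> <[s]> by rewrite mulKs.
  by rewrite groupM //; apply: (subsetP (joing_subl _ _)); apply: cycle_id.
- by case/orP=> /cycleP[k ->]; rewrite groupX ?groupM // mem_gen ?inE ?eqxx ?orbT.
Qed.

Lemma sW : s \in W. Proof. by rewrite defW mem_gen ?inE ?eqxx. Qed.
Lemma tW : t \in W. Proof. by rewrite defW mem_gen ?inE ?eqxx ?orbT. Qed.
Lemma rW : r \in W. Proof. by rewrite groupM ?sW ?tW. Qed.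

Lemma rot_W x : x \in rot -> x \in W.
Proof. by case/cycleP=> k ->; rewrite groupX ?rW. Qed.

Lemma WE x : (x \in W) = (x \in rot) || (x * s \in rot).
Proof.
apply/idP/idP; last first.
  by case/orP=> [/rot_W//|/rot_W xs]; rewrite -[x]mulsK groupM ?sW.
rewrite W_mul => /mulsgP[y _ yr /cycleP[k ->] ->].
rewrite -(odd_double_half k) expgD -mul2n expgM expg2 ss expg1n mulg1.
by case: odd; rewrite ?expg0 ?expg1 ?mulsK ?mulg1 yr ?orbT.
Qed.

Lemma rot_s_notin x : x \in rot -> x * s \notin rot.
Proof. by move=> xr; rewrite groupMl // s_notin_rot. Qed.

Lemma in_rot_W x : x \in W -> (x * s \in rot) = (x \notin rot).
Proof.
rewrite WE; have [xr _|] := boolP (x \in rot); last by [].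
exact/negbTE/rot_s_notin.
Qed.

Lemma card_rot : #|rot| = m. Proof. by rewrite -or. Qed.

Lemma card_W : #|W| = m.*2.
Proof.
rewrite W_mul TI_cardMg; first by rewrite card_rot -orderE os muln2.
apply/trivgP/subsetP=> x; rewrite !inE => /andP[xr /cycleP[k defx]].
move: xr; rewrite defx -(odd_double_half k) expgD -mul2n expgM expg2 ss expg1n mulg1.
by case: odd; rewrite ?expg0 // expg1 (negbTE s_notin_rot).
Qed.

(* For [c <= m], [alt c] is the alternating word [s t s ...] of length [c], and
   [alt (m.*2 - c)] is the alternating word [t s t ...] of length [c]. *)
Definition alt (c : nat) : gT := r ^+ c./2 * s ^+ odd c.

Lemma alt_W c : alt c \in W.
Proof. by rewrite groupM ?groupX ?rW ?sW. Qed.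

Lemma alt_rot c : (alt c \in rot) = ~~ odd c.
Proof.
rewrite groupMl ?mem_cycle //; case: odd; last by rewrite group1.
by rewrite expg1 (negbTE s_notin_rot).
Qed.

Lemma alt_inj c d : (c < m.*2)%N -> (d < m.*2)%N -> alt c = alt d -> c = d.
Proof.
move=> cm dm eqcd.
have eqo : odd c = odd d by apply: negb_inj; rewrite -!alt_rot eqcd.
have /eqP : r ^+ c./2 = r ^+ d./2 by move: eqcd; rewrite /alt eqo => /mulIg.
rewrite eq_expg_mod_order or !modn_small; lia.
Qed.

Lemma W_alt : W :=: [set alt c | c : 'I_m.*2].
Proof.
apply/esym/eqP; rewrite eqEcard card_W card_imset ?card_ord ?leqnn ?andbT.
  by apply/subsetP=> x /imsetP[c _ ->]; apply: alt_W.
by move=> c d /alt_inj-/(_ (ltn_ord c) (ltn_ord d)) /val_inj.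
Qed.

Lemma WP x : x \in W -> exists2 c, (c < m.*2)%N & x = alt c.
Proof. by rewrite W_alt => /imsetP[c _ ->]; exists c. Qed.

Lemma big_W (V : nmodType) (F : gT -> V) :
  (\sum_(x in W) F x = \sum_(x in rot) F x + \sum_(x in rot) F (x * s)%g)%R.
Proof.
rewrite (bigID (mem rot)) /=; congr (_ + _)%R.
  by apply: eq_bigl => x; rewrite WE; case: (x \in rot); rewrite ?andbF ?andbT.
rewrite (reindex_inj (mulIg s)); apply: eq_bigl => x /=.
case xr: (x \in rot); first by rewrite rot_s_notin // groupM ?sW // rot_W.
rewrite groupMr ?sW // WE xr /=; by case: (x * s \in rot).
Qed.

(** * Products of alternating words with generators, and the Coxeter length *)

Lemma rot_expV k : (k <= m)%N -> (r ^+ k)^-1 = r ^+ (m - k).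
Proof.
move=> km; apply/eqP; rewrite eq_invg_mul -expgD subnKC //.
by rewrite -or expg_order.
Qed.

Lemma alt_period c : alt (c + m.*2) = alt c.
Proof.
rewrite /alt oddD odd_double addbF halfD odd_double andbF add0n doubleK.
by rewrite expgD -or expg_order mulg1.
Qed.

(** On indices modulo [m.*2], left multiplication by [s] is the reflection [c |-> 1 - c], and that
    by [t] is [c |-> - 1 - c]. Adding [m.*2] keeps the indices natural numbers. *)
Lemma mul_s_alt c : (c <= m.*2.+1)%N -> s * alt c = alt (m.*2.+1 - c).
Proof.
move=> cm; rewrite /alt mulgA (mul_s_rot (mem_cycle r c./2)) rot_expV; last lia.
rewrite -mulgA; congr (_ * _).
  congr (_ ^+ _); lia.
have -> : odd (m.*2.+1 - c) = ~~ odd c by lia.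
by case: odd; rewrite ?expg0 ?expg1 ?mulg1 ?ss.
Qed.

Lemma mul_t_alt c : (c < m.*2)%N -> t * alt c = alt (m.*2.-1 - c).
Proof.
move=> cm; have -> : (m.*2.-1 - c = m.*2.+1 - c.+2)%N by lia.
rewrite -mul_s_alt; last lia.
by rewrite /alt /= negbK expgS !mulgA ss mul1g.
Qed.

Lemma alt0 : alt 0 = 1.
Proof. by rewrite /alt /= !expg0 mulg1. Qed.

Lemma altS c : alt c.+1 = alt c * (if odd c then t else s).
Proof.
rewrite /alt /= uphalf_half; case: odd => /=; last by rewrite expg0 !expg1 mulg1.
by rewrite expg0 expg1 mulg1 expgSr mulgA.
Qed.

Lemma alt_pred c : alt c = alt c.+1 * (if odd c then t else s).
Proof. by rewrite altS -mulgA; case: odd; rewrite ?ss ?tt mulg1. Qed.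

Lemma wordsE n : words s t n = Sset s t ^+ n.
Proof. by elim: n => [|n IHn] //=; rewrite IHn expgS. Qed.

Lemma wordsM n x a : x \in words s t n -> a \in Sset s t -> x * a \in words s t n.+1.
Proof. by rewrite !wordsE expgSr => xn aS; apply: mem_mulg. Qed.

Lemma letter_S c : (if odd c then t else s) \in Sset s t.
Proof. by case: odd; rewrite !inE eqxx ?orbT. Qed.

Lemma alt_words c : alt c \in words s t c.
Proof.
elim: c => [|c IHc]; first by rewrite alt0 inE.
by rewrite altS wordsM // letter_S.
Qed.

Lemma alt_words_sub c : (c <= m.*2)%N -> alt (m.*2 - c) \in words s t c.
Proof.
elim: c => [_|c IHc cm].
  by rewrite subn0 -[m.*2]add0n alt_period alt0 inE.
rewrite alt_pred -subSn // subSS wordsM ?letter_S // IHc //.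
exact: ltnW.
Qed.

(** The last condition says that the distance of [c] from [0] modulo [m.*2] is at most [n]. The
    index reflections of [mul_s_alt] and [mul_t_alt] raise this distance by at most one. *)
Lemma words_alt n x : x \in words s t n ->
  exists c, [/\ (c <= m.*2)%N, x = alt c & (c <= n)%N || (m.*2 <= c + n)%N].
Proof.
elim: n x => [x|n IHn x].
  by rewrite inE => /eqP->; exists 0%N; rewrite alt0.
case/mulsgP=> a y aS /IHn[c [cm -> cn]] ->{x}.
move: aS; rewrite !inE => /orP[]/eqP->{a}.
  (* Here [mul_s_alt] would give the index [m.*2.+1], which is out of range; one period lower it is
     [1]. *)
  have [->|c0] := posnP c.
    exists 1%N; split; [lia | by rewrite altS alt0 mulg1 mul1g | lia].
  by exists (m.*2.+1 - c)%N; split; [lia | rewrite mul_s_alt //; lia | lia].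
have [c2m|c2m] := eqVneq c m.*2.
  exists m.*2.-1; split; [lia | | lia].
  rewrite c2m -[m.*2]add0n alt_period mul_t_alt; last lia.
  by congr alt; lia.
by exists (m.*2.-1 - c)%N; split; [lia | rewrite mul_t_alt //; lia | lia].
Qed.

(** The two alternating spellings give the upper bound; [words_alt] and the injectivity of [alt]
    show that no word is shorter. *)
Lemma clen_alt c : (c < m.*2)%N -> clen s t (alt c) = minn c (m.*2 - c).
Proof.
move=> cm; rewrite /clen.
set n := minn c _.
have cn : alt c \in words s t n.
  rewrite /n /minn; case: ifP => _; first exact: alt_words.
  by rewrite -{1}(subKn (ltnW cm)) alt_words_sub // leq_subr.
(* The search in [clen] is bounded, so [n] has to be within the bound for [find] to succeed. *)
have nG : (n < #|gT|.+1)%N.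
  rewrite ltnS (leq_trans _ (max_card (mem W))) // card_W /n; lia.
have has_n : has (fun n => alt c \in words s t n) (iota 0 #|gT|.+1).
  by apply/hasP; exists n => //; rewrite mem_iota.
apply/eqP; rewrite eqn_leq; apply/andP; split.
  rewrite leqNgt; apply/negP=> /(before_find 0%N).
  by rewrite nth_iota // add0n cn.
have := nth_find 0%N has_n; move: has_n; rewrite has_find size_iota => fG.
rewrite nth_iota // add0n => /words_alt[d [dm eqd hd]].
(* The index [m.*2] is a second name for the identity and lies outside the range of [alt_inj]. *)
have [d2m|d2m] := eqVneq d m.*2.
  have c0 : c = 0%N.
    apply: alt_inj => //; first lia.
    by rewrite eqd d2m -[m.*2]add0n alt_period.
  by rewrite /n c0 min0n.
have cd : c = d by apply: alt_inj => //; lia.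
move: hd; rewrite -cd /n; lia.
Qed.

(** * The sign character and the longest element *)

(** [minn c (m.*2 - c)] has the parity of [c], and [alt c] is a rotation exactly for even [c]. *)
Lemma sgn_W x : x \in W -> sgnS s t x = ((-1) ^+ (x \notin rot))%R.
Proof.
case/WP=> c cm ->; rewrite /sgnS clen_alt // alt_rot negbK -signr_odd.
by congr (_ ^+ nat_of_bool _)%R; lia.
Qed.

Lemma refl_invol x : x \in W -> x \notin rot -> x * x = 1.
Proof.
move=> xW; rewrite -in_rot_W // => xr.
by rewrite -{2}(mulsK x) mul_rot_s // invMg invs mulgA mulgA mulsK mulgV.
Qed.

Lemma refl_inv x : x \in W -> x \notin rot -> x^-1 = x.
Proof. by move=> xW xr; apply/eqP; rewrite eq_invg_mul refl_invol. Qed.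

Lemma sgn_M x y : x \in W -> y \in W ->
  sgnS s t (x * y) = (sgnS s t x * sgnS s t y)%R.
Proof.
move=> xW yW; rewrite !sgn_W ?(groupM xW yW) // -signr_addb; congr (_ ^+ nat_of_bool _)%R.
have [xr|xr] := boolP (x \in rot); first by rewrite groupMl.
have [yr|yr] := boolP (y \in rot); first by rewrite groupMr // (negbTE xr).
have -> : x * y = (x * s) * (y * s)^-1.
  by rewrite invMg mulgA mulgK refl_inv.
move: xr yr; rewrite -in_rot_W // -in_rot_W // => xr yr.
by rewrite groupMl // groupV yr.
Qed.

(** [minn c (m.*2 - c)] attains its maximum only at [c = m], so the choice made by [arg max] is
    forced. *)
Lemma longest_alt : longest s t W = alt m.
Proof.
rewrite /longest; case: arg_maxnP => [|w /WP[c cm ->] /(_ (alt m) (alt_W m))].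
  exact: group1.
rewrite !clen_alt //; last lia.
by move=> le_mc; congr alt; lia.
Qed.

Lemma w0_invol : alt m * alt m = 1.
Proof.
have [mo|me] := boolP (odd m).
  by rewrite refl_invol ?alt_W // alt_rot mo.
rewrite /alt (negbTE me) expg0 mulg1 -expgD addnn halfK (negbTE me) subn0.
by rewrite -or expg_order.
Qed.

Lemma w0_neq1 : alt m != 1.
Proof.
apply/eqP; rewrite -alt0 => /alt_inj eqm.
by have := m_gt1; rewrite eqm //; lia.
Qed.

(** * Coset representatives and the numbers [mKL] *)

Lemma XsetE (J : {set gT}) x : J \subset Sset s t ->
  (x \in Xset s t W J) =
  [&& x \in W, (s \in J) ==> (clen s t x < clen s t (s * x))%N
    & (t \in J) ==> (clen s t x < clen s t (t * x))%N].
Proof.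
move=> sJ; rewrite inE; congr (_ && _).
apply/forall_inP/andP=> [JX|[sX tX] a aJ].
  by split; apply/implyP=> /JX.
by have := subsetP sJ a aJ; rewrite !inE => /orP[]/eqP aE; move: aJ; rewrite aE; apply/implyP.
Qed.

Lemma alt_s_len c : (c < m.*2)%N ->
  (clen s t (alt c) < clen s t (s * alt c))%N = (c == 0)%N || (m < c)%N.
Proof.
move=> cm; rewrite mul_s_alt; last lia.
(* For [c <= 1] the index [m.*2.+1 - c] is at least [m.*2], so a period is removed before [clen_alt]
   applies. *)
have [->|c0] := posnP c.
  rewrite subn0 -[m.*2.+1]add1n alt_period !clen_alt; lia.
have [c1|c1] := eqVneq c 1%N.
  rewrite c1 subSS subn0 -(add0n m.*2) alt_period !clen_alt; lia.
rewrite !clen_alt; lia.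
Qed.

Lemma alt_t_len c : (c < m.*2)%N ->
  (clen s t (alt c) < clen s t (t * alt c))%N = (c < m)%N.
Proof. by move=> cm; rewrite mul_t_alt // !clen_alt; lia. Qed.

Lemma s_neq_t : s != t.
Proof.
by apply/eqP=> st; move: or m_gt1; rewrite -st ss order1 => <-.
Qed.

Lemma alt_Xset (J : {set gT}) c : (c < m.*2)%N -> J \subset Sset s t ->
  (alt c \in Xset s t W J) =
  ((s \in J) ==> ((c == 0) || (m < c))%N) && ((t \in J) ==> (c < m)%N).
Proof.
by move=> cm sJ; rewrite XsetE // alt_W alt_s_len // alt_t_len.
Qed.

(** [a ^ x] lies in [S] when [a * x] is [x * s] or [x * t]. For [x = alt c] these are the neighbours
    with indices [c + 1] and [c - 1]; a period is added so that [c = 0] has a predecessor. *)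
Lemma conj_S c a : a \in W ->
  (a ^ alt c \in Sset s t) =
  (a * alt c == alt c.+1) || (a * alt c == alt (c + m.*2).-1).
Proof.
move=> aW.
have -> : alt (c + m.*2).-1 = alt c * (if odd c then s else t).
  have [k ck] : exists k, (c + m.*2 = k.+1)%N by exists (c + m.*2).-1; lia.
  rewrite -(alt_period c) ck [LHS]alt_pred.
  have -> : odd k = ~~ odd c by lia.
  by case: (odd c).
rewrite altS !inE.
have conjE b : (a ^ alt c == b) = (a * alt c == alt c * b).
  by rewrite conjgE -(inj_eq (mulgI (alt c))) mulKVg.
by rewrite !conjE; case: odd; rewrite // orbC.
Qed.

(** Turns counting in [W] into listing indices, a question of linear arithmetic. *)
Lemma card_set_alt (A : {set gT}) (ns : seq nat) : A \subset W ->
    uniq ns -> {in ns, forall c, c < m.*2}%N ->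
    (forall c, (c < m.*2)%N -> (alt c \in A) = (c \in ns)) ->
  #|A| = size ns.
Proof.
move=> sAW uns nsm memA.
rewrite -(size_map alt) -(card_uniqP _); last first.
  by rewrite map_inj_in_uniq // => c d /nsm cm /nsm dm; apply: alt_inj.
apply: eq_card => x; apply/idP/mapP=> [xA|[c cns ->]]; last first.
  by rewrite memA // nsm.
by have /WP[c cm defx] := subsetP sAW x xA; exists c; rewrite // -memA // -defx.
Qed.

Lemma Xset_subW J : Xset s t W J \subset W.
Proof. by apply/subsetP=> x; rewrite inE => /andP[]. Qed.

Lemma s_notin1t : s \in [set t] = false.
Proof. by rewrite inE (negbTE s_neq_t). Qed.

Lemma t_notin1s : t \in [set s] = false.
Proof. by rewrite inE eq_sym (negbTE s_neq_t). Qed.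

Lemma s1_sub : [set s] \subset Sset s t.
Proof. by rewrite sub1set !inE eqxx. Qed.

Lemma t1_sub : [set t] \subset Sset s t.
Proof. by rewrite sub1set !inE eqxx orbT. Qed.

Lemma card_Xs : #|Xset s t W [set s]| = m.
Proof.
rewrite (@card_set_alt _ (0%N :: iota m.+1 m.-1)) ?Xset_subW //=.
- rewrite size_iota; lia.
- rewrite mem_iota iota_uniq; lia.
- by move=> c; rewrite inE mem_iota; lia.
move=> c cm; rewrite alt_Xset ?s1_sub // t_notin1s !inE mem_iota eqxx /=; lia.
Qed.

Lemma card_Xt : #|Xset s t W [set t]| = m.
Proof.
rewrite (@card_set_alt _ (iota 0 m)) ?Xset_subW ?size_iota ?iota_uniq //=.
- by move=> c; rewrite mem_iota; lia.
move=> c cm; rewrite alt_Xset ?t1_sub // s_notin1t !inE mem_iota eqxx /=; lia.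
Qed.

Lemma alt_eq c d : (c < m.*2)%N -> (d < m.*2)%N -> (alt c == alt d) = (c == d).
Proof. by move=> cm dm; apply/eqP/eqP=> [/alt_inj->|->]. Qed.

(** The two elements are [1] and [alt m.+1 = s * alt m]: conjugation by the longest element
    preserves [S]. *)
Lemma m_ss : mKL s t W [set s] [set s] = 2%N.
Proof.
rewrite /mKL subxx (@card_set_alt _ [:: 0%N; m.+1]) //.
- by rewrite (subset_trans (subsetIl _ _)) ?Xset_subW.
- by move=> c; rewrite !inE; lia.
move=> c cm; rewrite inE [alt c \in Xsharp _ _ _ _]inE conjg_set1 sub1set.
rewrite alt_Xset ?s1_sub // t_notin1s set11 /= andbT.
rewrite conj_S ?sW // mul_s_alt; last lia.
have [->|c0] := posnP c; first by rewrite subn0 -[m.*2.+1]add1n alt_period eqxx.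
rewrite !inE; case: (ltnP m c) => mc; last by rewrite andFb; lia.
have -> : (c + m.*2).-1 = (c.-1 + m.*2)%N by lia.
rewrite alt_period /= (alt_eq (d := c.-1)); [|lia|lia].
suff -> : (alt (m.*2.+1 - c) == alt c.+1) = false by lia.
have [c2|c2] := eqVneq c m.*2.-1; last by rewrite alt_eq; lia.
have -> : c.+1 = (0 + m.*2)%N by lia.
by rewrite alt_period alt_eq; lia.
Qed.

(** The two elements are [1] and [alt m.-1 = t * alt m]. *)
Lemma m_tt : mKL s t W [set t] [set t] = 2%N.
Proof.
rewrite /mKL subxx (@card_set_alt _ [:: 0%N; m.-1]) //.
- by rewrite (subset_trans (subsetIl _ _)) ?Xset_subW.
- by rewrite /= inE andbT; lia.
- by move=> c; rewrite !inE; lia.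
move=> c cm; rewrite inE [alt c \in Xsharp _ _ _ _]inE conjg_set1 sub1set.
rewrite alt_Xset ?t1_sub // s_notin1t set11 /=.
rewrite conj_S ?tW // mul_t_alt // !inE.
case: (ltnP c m) => mc; last by rewrite andFb; lia.
rewrite (alt_eq (d := c.+1)); [|lia|lia].
have [c0|c0] := posnP c; first by rewrite c0 add0n subn0 eqxx orbT.
have -> : (c + m.*2).-1 = (c.-1 + m.*2)%N by lia.
by rewrite alt_period alt_eq; lia.
Qed.

Lemma proper1 (x : gT) (L : {set gT}) : (L \proper [set x]) = (L == set0).
Proof.
apply/idP/eqP=> [|->]; last by rewrite properE sub0set subset0 -cards_eq0 cards1.
by rewrite properE subset1 => /andP[/orP[]/eqP->//]; rewrite subxx.
Qed.

Lemma big_proper_S (V : nmodType) (F : {set gT} -> V) :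
  (\sum_(L : {set gT} | L \proper Sset s t) F L
    = F set0 + F [set s] + F [set t])%R.
Proof.
have proper0 : set0 \proper Sset s t.
  by rewrite proper0 -card_gt0 cards2 s_neq_t.
have propers : [set s] \proper Sset s t.
  by rewrite properEcard s1_sub cards1 cards2 s_neq_t.
have propert : [set t] \proper Sset s t.
  by rewrite properEcard t1_sub cards1 cards2 s_neq_t.
have ns0 x : [set x] != set0 :> {set gT} by rewrite -cards_eq0 cards1.
have st : [set t] != [set s].
  by apply/eqP=> /setP/(_ t); rewrite t_notin1s set11.
rewrite (bigD1 set0) //= (bigD1 [set s]) ?propers ?ns0 //=.
rewrite (bigD1 [set t]) ?propert ?ns0 ?st //= big1 ?addr0 ?addrA // => L.
case/andP=> /andP[/andP[pL L0] Ls] Lt.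
have : (#|L| < 2)%N by have := proper_card pL; rewrite cards2 s_neq_t.
rewrite ltnS leq_eqVlt ltnS leqn0 cards_eq0 (negbTE L0) orbF => /cards1P[x defL].
have /subsetP/(_ x) := proper_sub pL; rewrite defL set11 => /(_ isT).
by rewrite !inE => /orP[]/eqP xE; move: Ls Lt; rewrite defL xE eqxx.
Qed.

Local Open Scope ring_scope.

(** * The coefficients of [e_S], and its idempotence *)

Lemma gelE (g h : gT) : gel g 0 (enum_rank h) = (g == h)%:R.
Proof. by rewrite mxE eqxx /= (inj_eq enum_rank_inj) eq_sym. Qed.

Lemma xKE K (g : gT) :
  xK s t W K 0 (enum_rank g) = (g^-1%g \in Xset s t W K)%:R.
Proof.
rewrite summxE; under eq_bigr do rewrite gelE.
rewrite -sum_delta; apply: eq_bigr => x _.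
by rewrite eq_invg_sym eq_sym.
Qed.

Lemma Xset0 : Xset s t W set0 = W.
Proof. by apply/setP=> x; rewrite XsetE ?sub0set // !inE /= andbT. Qed.

Lemma XsetS : Xset s t W (Sset s t) = [set 1%g].
Proof.
apply/setP=> x; rewrite in_set1; apply/idP/eqP=> [xX|->].
  have /WP[c cm defx] := subsetP (Xset_subW _) x xX.
  move: xX; rewrite defx alt_Xset // !inE !eqxx orbT /= => cc.
  by rewrite -alt0; congr alt; lia.
by rewrite -alt0 alt_Xset //; lia.
Qed.

(* [x_s + x_t] runs over all of [W] but [w0], and hits [1] twice. *)
Lemma eL_S g : eL s t W (Sset s t) 0 (enum_rank g) =
  ((g == 1%g)%:R + (g == alt m)%:R) / 2 - (g \in W)%:R / (m.*2)%:R.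
Proof.
have Xsh0 : Xsharp s t W set0 = W.
  by apply/setP=> x; rewrite inE Xset0 conj0g sub0set andbT.
have m00 : mKL s t W set0 set0 = m.*2 by rewrite /mKL subxx Xset0 Xsh0 setIid card_W.
have ms0 : mKL s t W [set s] set0 = m.
  by rewrite /mKL sub0set Xsh0 (setIidPl (Xset_subW _)) card_Xs.
have mt0 : mKL s t W [set t] set0 = m.
  by rewrite /mKL sub0set Xsh0 (setIidPl (Xset_subW _)) card_Xt.
have mS (L : {set gT}) : L \subset Sset s t -> mKL s t W (Sset s t) L = 1%N.
  move=> sL; rewrite /mKL sL XsetS (setIidPl _) ?cards1 // sub1set inE conjsg1 sL.
  by rewrite -alt0 alt_Xset /= ?(ltnW m_gt1) ?implybT //; lia.
(* The empty set has no proper subset, so the fuel [k] does not affect the value. *)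
have e0 k : eaux s t W k set0 = (m.*2)%:R^-1 *: xK s t W set0.
  case: k => [|k] /=; rewrite m00 ?subr0 // big_pred0 ?subr0 // => L.
  by rewrite properE subset0; case: eqP => // ->; rewrite sub0set.
have -> : eL s t W (Sset s t) = (mKL s t W (Sset s t) (Sset s t))%:R^-1 *:
    (xK s t W (Sset s t) - \sum_(L : {set gT} | L \proper Sset s t)
       (mKL s t W (Sset s t) L)%:R *: eaux s t W 1 L).
  by rewrite /eL cards2 s_neq_t.
rewrite big_proper_S.
rewrite !mS ?subxx ?sub0set ?s1_sub ?t1_sub //.
rewrite invr1 !scale1r e0.
have -> : eaux s t W 1 [set s] = 2^-1 *: (xK s t W [set s] - m%:R *: eaux s t W 0 set0).
  by rewrite /= m_ss (eq_bigl _ _ (proper1 s)) big_pred1_eq ms0.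
have -> : eaux s t W 1 [set t] = 2^-1 *: (xK s t W [set t] - m%:R *: eaux s t W 0 set0).
  by rewrite /= m_tt (eq_bigl _ _ (proper1 t)) big_pred1_eq mt0.
rewrite e0 !mxE !xKE Xset0 XsetS inE groupV invg_eq1.
have mn0 : m%:R != 0 :> algC by rewrite pnatr_eq0; lia.
have m2n0 : m.*2%:R = 2 * m%:R :> algC by rewrite -mul2n natrM.
have w0V : (alt m)^-1%g = alt m.
  by apply/eqP; rewrite eq_invg_mul w0_invol.
have -> : (g == alt m) = (g^-1%g == alt m) by rewrite eq_invg_sym w0V eq_sym.
have -> : (g == 1%g) = (g^-1%g == alt 0) by rewrite alt0 invg_eq1.
rewrite -groupV; set h := g^-1%g.
have [hW|hW] := boolP (h \in W); last first.
  have nX J : (h \in Xset s t W J) = false.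
    by apply/negP=> /(subsetP (Xset_subW _)) hW'; rewrite hW' in hW.
  have na c : (h == alt c) = false.
    by apply/negP=> /eqP hc; rewrite hc alt_W in hW.
  by rewrite !nX !na m2n0 /=; field.
have [c cm hE] := WP hW; rewrite hE.
rewrite !alt_Xset ?s1_sub ?t1_sub // s_notin1t t_notin1s !set11 /= !alt_eq //; try lia.
rewrite andbT m2n0.
(* Only four of the sixteen truth assignments occur, namely those for [c = 0], [m < c], [0 < c < m]
   and [c = m]. In each the identity is one of rational functions in [m]. *)
have : [|| [&& (c == 0) || (m < c), c < m, c == 0 & c != m],
          [&& (c == 0) || (m < c), ~~ (c < m), c != 0 & c != m],
          [&& ~~ ((c == 0) || (m < c)), c < m, c != 0 & c != m]
        | [&& ~~ ((c == 0) || (m < c)), ~~ (c < m), c != 0 & c == m]]%N by lia.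
case: ((c == 0) || (m < c))%N; case: (c < m)%N; case: (c == 0)%N;
  case: (c == m)%N => //= _; field; exact: mn0.
Qed.

Let f (g : gT) : algC := eL s t W (Sset s t) 0 (enum_rank g).

Let mR_neq0 : m%:R != 0 :> algC.
Proof. by rewrite pnatr_eq0 -lt0n ltnW. Qed.

Let m2_neq0 : m.*2%:R != 0 :> algC.
Proof. by rewrite pnatr_eq0 double_eq0; lia. Qed.

Lemma eL_conv (F : gT -> algC) :
  \sum_(y in W) f y * F y
    = (F 1%g + F (alt m)) / 2 - (\sum_(y in W) F y) / (m.*2)%:R.
Proof.
under eq_bigr do rewrite /f eL_S mulrBl mulrAC (mulrAC _ _ (F _)) mulrDl.
rewrite sumrB -!mulr_suml big_split /= !sum_deltaM alt_W group1 !mul1r.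
by congr (_ - _ / _); apply: eq_bigr => y ->; rewrite mul1r.
Qed.

Lemma eL_sum : \sum_(y in W) f y = 0.
Proof.
have := eL_conv (fun=> 1); under eq_bigr do rewrite mulr1.
rewrite sumr_const card_W => ->.
by rewrite -[1 + 1]/(2 : algC) !divff ?pnatr_eq0 ?subrr // -(pnatr_eq0 algC).
Qed.

Lemma eL_supp x : x \notin W -> f x = 0.
Proof.
move=> xW; rewrite /f eL_S (negbTE xW).
have [x1|_] := eqVneq x 1%g; first by rewrite x1 group1 in xW.
have [x1|_] := eqVneq x (alt m); first by rewrite x1 alt_W in xW.
by rewrite addr0 !mul0r subrr.
Qed.

Lemma w0_inv : (alt m)^-1%g = alt m.
Proof. by apply/eqP; rewrite eq_invg_mul w0_invol. Qed.

Lemma eL_V x : f x^-1%g = f x.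
Proof. by rewrite /f !eL_S groupV invg_eq1 eq_invg_sym w0_inv (eq_sym x). Qed.

(** The coefficients of [e_S] sum to [0] and are invariant under translation by [alt m]. Hence the
    averaging part of [e_S] kills [e_S], and [(1 + alt m) / 2] fixes it. *)
Lemma eL_idem h : \sum_(y in W) f y * f (h * y^-1)%g = f h.
Proof.
rewrite eL_conv invg1 mulg1 w0_inv.
have -> : \sum_(y in W) f (h * y^-1)%g = 0.
  rewrite (reindex_inj invg_inj) /=.
  under eq_bigl do rewrite groupV.
  have [hW|hW] := boolP (h \in W); last first.
    by apply: big1 => y yW; rewrite invgK eL_supp // groupMr.
  rewrite -[RHS]eL_sum [RHS](reindex_inj (mulgI h)) /=.
  by apply: eq_big => [y|y _]; rewrite ?invgK ?groupMl //.
have -> : f (h * alt m)%g = f h.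
  rewrite /f !eL_S groupMr ?alt_W //; congr (_ / _ - _).
  rewrite addrC; congr (_%:R + _%:R); rewrite -[in LHS](inj_eq (mulIg (alt m))).
    by rewrite -mulgA w0_invol mulg1.
  by rewrite -mulgA w0_invol mulg1 mul1g.
by rewrite mul0r subr0 mulrDl -splitr.
Qed.

(** * The module [e_S CW] and its character *)

(** Left multiplication by [e_S] on [CW], acting on row vectors and extended by zero rows outside
    [W]. *)
Let eS_mx : 'M[algC]_#|gT| :=
  \matrix_(i, j) ((enum_val i \in W)%:R * f (enum_val j * (enum_val i)^-1)%g).

Lemma gmul_gel (a : 'rV[algC]_#|gT|) g k :
  gmul a (gel g) 0 k = a 0 (enum_rank (enum_val k * g^-1)%g).
Proof.
rewrite mxE; under eq_bigr => i _.
  under eq_bigr do rewrite mxE eqxx mulrC /=.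
  rewrite sum_deltaM enum_rankK.
  have -> : (enum_val i * g == enum_val k)%g = (i == enum_rank (enum_val k * g^-1)%g).
    rewrite -(inj_eq enum_val_inj) enum_rankK; apply/eqP/eqP=> [<-|->].
      by rewrite mulgK.
    by rewrite mulgKV.
  over.
by rewrite sum_deltaM mul1r.
Qed.

Lemma row_eS_mx g : g \in W -> row (enum_rank g) eS_mx = gmul (eL s t W (Sset s t)) (gel g).
Proof.
move=> gW; apply/rowP=> k; rewrite gmul_gel mxE mxE enum_rankK gW mul1r //.
Qed.

Lemma eSCW_eS_mx : (eSCW s t W :=: eS_mx)%MS.
Proof.
apply/eqmxP/andP; split.
  by apply/sumsmx_subP=> g gW; rewrite genmxE -row_eS_mx // row_sub.
apply/row_subP=> i; have [iW|iW] := boolP (enum_val i \in W).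
  by apply: (sumsmx_sup (enum_val i)) => //; rewrite genmxE -row_eS_mx // enum_valK.
suff -> : row i eS_mx = 0 by exact: sub0mx.
by apply/rowP=> j; rewrite !mxE (negbTE iW) mul0r.
Qed.

Lemma eS_mx_idem : eS_mx *m eS_mx = eS_mx.
Proof.
apply/matrixP=> i j; rewrite !mxE.
under eq_bigr do rewrite !mxE.
rewrite -(big_enum_val (fun x => _ * f (x * (enum_val i)^-1)%g * ((x \in W)%:R * f (enum_val j * x^-1)%g))) /=.
have [iW|iW] := boolP (enum_val i \in W); last first.
  by rewrite mul0r big1 // => x _; rewrite !mul0r.
rewrite mul1r -[RHS]eL_idem (reindex_inj (mulIg (enum_val i))) /= [RHS]big_mkcond.
apply: eq_bigr => x _; rewrite mul1r groupMr // mulgK invMg mulgA.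
by case: (x \in W); rewrite ?mul1r // mul0r mulr0.
Qed.

Lemma mul_eS_mx_Rg w i j : (eS_mx *m Rg w) i j = eS_mx i (enum_rank (enum_val j * w^-1)%g).
Proof.
rewrite mxE; under eq_bigr => k _.
  rewrite [Rg _ _ _]mxE mulrC.
  have -> : (enum_val j == enum_val k * w)%g = (k == enum_rank (enum_val j * w^-1)%g).
    rewrite -(inj_eq enum_val_inj) enum_rankK; apply/eqP/eqP=> [->|->].
      by rewrite mulgK.
    by rewrite mulgKV.
  over.
by rewrite sum_deltaM mul1r.
Qed.

Lemma mul_Rg_eS_mx w i j : (Rg w *m eS_mx) i j = eS_mx (enum_rank (enum_val i * w)%g) j.
Proof.
rewrite mxE; under eq_bigr => k _.
  rewrite [Rg _ _ _]mxE.
  have -> : (enum_val k == enum_val i * w)%g = (k == enum_rank (enum_val i * w)%g).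
    by rewrite -(inj_eq enum_val_inj) enum_rankK.
  over.
by rewrite sum_deltaM mul1r.
Qed.

(** Left multiplication by [e_S] commutes with right multiplication by [w]. The diagonal entry at
    [x] of their product is the coefficient of [e_S] at [x w^-1 x^-1], which [eL_V] and the
    substitution of [x^-1] for [x] turn into that at [w ^ x]. *)
Lemma Phi_sum w : w \in W ->
  Phi_S s t W w = \sum_(x in W) ((w ^ x == 1)%:R + (w ^ x == alt m)%:R)%g / 2 - 1.
Proof.
move=> wW; have PR : eS_mx *m Rg w = Rg w *m eS_mx.
  apply/matrixP=> i j; rewrite mul_eS_mx_Rg mul_Rg_eS_mx !mxE !enum_rankK groupMr //.
  by rewrite invMg mulgA.
rewrite /Phi_S (restr_trace_idem eSCW_eS_mx eS_mx_idem); last by rewrite {1}PR -mulmxA eS_mx_idem -PR.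
rewrite /mxtrace.
under eq_bigr do rewrite mul_eS_mx_Rg mxE enum_rankK.
rewrite -(big_enum_val (fun x => (x \in W)%:R * f (x * w^-1 * x^-1)%g)) /=.
rewrite (reindex_inj invg_inj) /=.
transitivity (\sum_(x in W) f (w ^ x)).
  rewrite [RHS]big_mkcond; apply: eq_bigr => x _.
  rewrite groupV; case: (x \in W); rewrite ?mul0r // mul1r -eL_V conjgE.
  by rewrite !invMg !invgK mulgA.
rewrite (eq_bigr _ (fun x xW => eL_S (w ^ x)%g)) sumrB; congr (_ - _).
rewrite (eq_bigr (fun=> m.*2%:R^-1)) => [|x xW]; last by rewrite groupJ // mul1r.
by rewrite sumr_const card_W -[_ *+ _]mulr_natr mulVf.
Qed.

Lemma order_w0 : #[alt m]%g = 2%N.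
Proof. by apply: nt_prime_order; rewrite ?expg2 ?w0_invol // w0_neq1. Qed.

Lemma Phi_Ind x : x \in W ->
  Phi_S s t W x = ('Ind[W, <[alt m]>%G] 1 - 1) x.
Proof.
move=> xW; rewrite Phi_sum // !cfunE cfIndE ?cycle_subG ?alt_W // cfun1E xW.
rewrite -orderE order_w0 mulrC mulr_suml; congr (_ - _).
apply: eq_bigr => y _; rewrite cfun1E; congr (_ / _).
rewrite /= cycle2g ?order_w0 // !inE.
have [->|_] := eqVneq (x ^ y)%g 1%g; last by rewrite add0r.
by rewrite eq_sym (negbTE w0_neq1) addr0.
Qed.

(** * Conjugation in [W] and the values of [Phi_S] *)

Lemma conj_in_rot x y : y \in W -> (x ^ y \in rot)%g = (x \in rot).
Proof.
move=> yW; suff nrot : y \in 'N(rot)%g by rewrite memJ_norm.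
move: yW; rewrite W_mul => /mulsgP[z u zr us ->].
rewrite groupM ?(subsetP (normG _) z) // (subsetP _ u us) // cycle_subG inE.
apply/subsetP=> _ /imsetP[v vr ->].
by rewrite conj_rot_s ?groupV.
Qed.

Lemma conj_rot_rot x y : x \in rot -> y \in rot -> (x ^ y)%g = x.
Proof. by move=> xr yr; rewrite conjgE (rot_comm xr yr) mulKg. Qed.

Lemma conj_rot_refl x y : x \in rot -> y \in rot -> (x ^ (y * s))%g = x^-1%g.
Proof. by move=> xr yr; rewrite conjgM (conj_rot_rot xr yr) conj_rot_s. Qed.

(** The element [alt m] is the involution of [rot] when [m] is even. When [m] is odd it is a
    reflection, so its term vanishes for a rotation [x]. *)
Lemma rot_invol x : x \in rot ->
  (x * x == 1)%g%:R = (x == 1%g)%:R + (x == alt m)%:R :> algC.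
Proof.
case/cyclePmin=> k; rewrite or => km ->.
have altk : alt k.*2 = (r ^+ k)%g by rewrite /alt odd_double doubleK mulg1.
rewrite -expgD -order_dvdn or -altk -alt0 !alt_eq; try lia.
have [->|k0] := posnP k; first by rewrite dvdn0 eqxx [0%N.*2]/= ltn_eqF ?addr0 //; lia.
rewrite double_eq0 -(negbK (k == 0)%N) -lt0n k0 add0r; congr (nat_of_bool _)%:R.
apply/idP/eqP=> [/dvdnP[[|[|q]]]|<-]; last by rewrite addnn.
- lia.
- lia.
- rewrite !mulSn; lia.
Qed.

Lemma Phi_rot x : x \in rot -> Phi_S s t W x = m%:R * (x * x == 1)%g%:R - 1.
Proof.
move=> xr; rewrite Phi_sum ?rot_W // big_W rot_invol //; congr (_ - _).
rewrite (eq_bigr (fun=> ((x == 1%g)%:R + (x == alt m)%:R) / 2)) => [|y yr]; last first.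
  by rewrite conj_rot_rot.
rewrite [X in _ + X](eq_bigr (fun=> ((x == 1%g)%:R + (x == alt m)%:R) / 2)) => [|y yr].
  by rewrite !sumr_const card_rot -mulrnDl -splitr mulrC mulr_natr.
by rewrite conj_rot_refl // invg_eq1 eq_invg_sym w0_inv (eq_sym x).
Qed.

(** In a cyclic group of odd order [m], squaring is inverted by the power [(m + 1) / 2]. *)
Lemma rot_sqrt x y : odd m -> x \in rot -> y \in rot ->
  (y * y == x)%g = (y == x ^+ m.+1./2)%g.
Proof.
move=> mo xr yr.
have expm u : u \in rot -> (u ^+ m.+1 = u)%g.
  by move=> ur; rewrite expgS -card_rot expg_cardG // mulg1.
have mE : (m.+1 = m.+1./2 + m.+1./2)%N by lia.
apply/eqP/eqP=> [<-|->].
  by rewrite -expg2 -expgM mul2n -addnn -mE expm.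
by rewrite -expgD -mE expm.
Qed.

(** Conjugating [x * s] by a rotation [u] gives [x * u^-2 * s], so [u] must be the unique square
    root of [x * y^-1]. *)
Lemma refl_transporter x y : odd m -> x \in rot -> y \in rot ->
  \sum_(u in rot) ((x * s) ^ u == y * s)%g%:R = 1 :> algC.
Proof.
move=> mo xr yr.
rewrite (eq_bigr (fun u => (u == (x * y^-1) ^+ m.+1./2)%g%:R)) => [|u ur].
  by rewrite sum_delta groupX ?groupM ?groupV.
rewrite -rot_sqrt ?groupM ?groupV //.
rewrite conjgE -mulgA (mul_s_rot ur) !mulgA (inj_eq (mulIg s)).
rewrite (rot_comm (groupVr ur) xr) -mulgA -invMg; congr (nat_of_bool _)%:R.
rewrite -(inj_eq (mulIg (u * u)%g)) mulgKV -[RHS](inj_eq (mulIg y)) mulgKV eq_sym.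
by rewrite (rot_comm yr) ?groupM.
Qed.

Lemma reflP x : x \in W -> x \notin rot -> exists2 y, y \in rot & x = (y * s)%g.
Proof. by move=> xW; rewrite -in_rot_W // => xr; exists (x * s)%g; rewrite ?mulsK. Qed.

Lemma conj_s_eq a u : u \in rot -> (a ^ s == u * s)%g = (a == u^-1 * s)%g.
Proof.
move=> ur; rewrite -(inj_eq (conjg_inj s) (a ^ s)%g) -conjgM ss conjg1.
by rewrite conjgE invs mulsK mul_s_rot.
Qed.

(** For even [m] the rotation [alt m] is not conjugate to a reflection. For odd [m] it is a
    reflection, and each of the two cosets of [rot] contains exactly one element carrying [x] to
    it. *)
Lemma Phi_refl x : x \in W -> x \notin rot -> Phi_S s t W x = (odd m)%:R - 1.
Proof.
move=> xW xr; rewrite Phi_sum //; congr (_ - _); rewrite -mulr_suml big_split /=.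
rewrite big1 ?add0r => [|y yW]; last first.
  by rewrite -(conj1g y) (inj_eq (conjg_inj y)); case: eqP => // x1; rewrite x1 group1 in xr.
have [mo|me] := boolP (odd m); last first.
  rewrite big1 ?mul0r // => y yW; case: eqP => // xyE.
  by move: xr; rewrite -(conj_in_rot _ yW) xyE alt_rot me.
have [z zr ->] := reflP xW xr.
have [u ur uE] : exists2 u, u \in rot & alt m = (u * s)%g.
  by apply: reflP; rewrite ?alt_W // alt_rot mo.
rewrite uE big_W refl_transporter //.
rewrite (eq_bigr (fun y => ((z * s) ^ y == u^-1 * s)%g%:R)) => [|y yr].
  by rewrite refl_transporter ?groupV // -[1 + 1]/(2 : algC) divff ?pnatr_eq0.
by rewrite conjgM conj_s_eq.
Qed.

(** * Reflections and those fixed under conjugation *)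

(** The permutation character of [W] on its reflections, the common value of [piA] and
    [Psi_S + 1]. *)
Definition nfix (x : gT) : algC := \sum_(a in rot) ((a * s) ^ x == a * s)%g%:R.

Lemma nfix_rot x : x \in rot -> nfix x = m%:R * (x * x == 1)%g%:R.
Proof.
move=> xr; rewrite /nfix (eq_bigr (fun=> (x * x == 1)%g%:R)) => [|a ar].
  by rewrite sumr_const card_rot mulrC mulr_natr.
congr (nat_of_bool _)%:R.
rewrite conjgE -mulgA (mul_s_rot xr) !mulgA (inj_eq (mulIg s)).
rewrite (rot_comm (groupVr xr) ar) -mulgA -invMg -{2}[a]mulg1 (inj_eq (mulgI a)).
by rewrite invg_eq1.
Qed.

(** With [x = z * s], a reflection [z * a * s] is fixed by [x] exactly when [a * a = 1], and
    [rot_invol] counts these rotations [a]. *)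
Lemma nfix_refl x : x \in W -> x \notin rot -> nfix x = 1 + (~~ odd m)%:R.
Proof.
move=> xW /(reflP xW)[z zr ->]; rewrite /nfix.
transitivity (\sum_(a in rot) (a * a == 1)%g%:R : algC); last first.
  rewrite (eq_bigr _ rot_invol) big_split /= !sum_delta group1.
  by rewrite alt_rot.
rewrite (reindex_inj (mulgI z)) /=; apply: eq_big => [a|a]; first by rewrite groupMl.
rewrite groupMl // => ar; congr (nat_of_bool _)%:R.
have zar : (z * a)%g \in rot by rewrite groupM.
have conjz : ((z * a * s) ^ z = a * z^-1 * s)%g.
  by rewrite conjgE -(mulgA (z * a)%g) (mul_s_rot zr) -!mulgA mulKg.
rewrite conjgM conjz conj_s_eq // (inj_eq (mulIg s)) invMg (inj_eq (mulIg _)).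
by rewrite eq_sym eq_invg_mul.
Qed.

Lemma t_refl : t = (r^-1 * s)%g.
Proof. by rewrite invMg invs invt mulsK. Qed.

Lemma conj_refl_rotV z y : z \in rot -> y \in rot ->
  ((z * s) ^ y^-1 = z * (y * y) * s)%g.
Proof.
move=> zr yr; rewrite conjgE invgK -(mulgA z) -(mul_rot_s yr) !mulgA.
by rewrite (rot_comm yr zr).
Qed.

(** Conjugating by powers of [r] shifts the exponent of [r ^+ k * s] by even numbers. Even [k] are
    reached from [s], and odd [k] from [t = r^-1 * s]. *)
Lemma reflsE x : (x \in refls s t W) = (x \in W) && (x \notin rot).
Proof.
apply/idP/andP=> [|[xW xr]].
  have tr : t \notin rot by rewrite {1}t_refl rot_s_notin // groupV cycle_id.
  rewrite inE => /orP[]/imsetP[y yW ->]; rewrite groupJ ?sW ?tW // conj_in_rot //.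
  by rewrite s_notin_rot.
have [z /cycleP[k ->] ->] := reflP xW xr.
have rkW j : ((r ^+ j)^-1)%g \in W by rewrite groupV groupX ?rW.
rewrite inE; apply/orP; have [ko|ke] := boolP (odd k); [right | left].
  suff <- : (t ^ (r ^+ k./2.+1)^-1 = r ^+ k * s)%g by apply: memJ_class.
  rewrite [t in (t ^ _)%g]t_refl conj_refl_rotV ?groupV ?mem_cycle ?cycle_id //.
  congr (_ * s)%g; rewrite -expgD addSn expgS mulKg; congr (_ ^+ _)%g; lia.
suff <- : (s ^ (r ^+ k./2)^-1 = r ^+ k * s)%g by apply: memJ_class.
rewrite -[s in (s ^ _)%g]mul1g conj_refl_rotV ?group1 ?mem_cycle // mul1g -expgD.
congr (_ ^+ _ * s)%g; lia.
Qed.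

Lemma big_refls (V : nmodType) (F : gT -> V) :
  \sum_(x in refls s t W) F x = \sum_(x in rot) F (x * s)%g.
Proof.
rewrite (reindex_inj (mulIg s)); apply: eq_bigl => x /=; rewrite reflsE.
rewrite groupMr ?sW //; have [xr|xr] := boolP (x \in rot).
  by rewrite rot_W // rot_s_notin.
by rewrite WE (negbTE xr) /=; case: (_ \in rot).
Qed.

Lemma card_refls : #|refls s t W| = m.
Proof.
apply/eqP; rewrite -(eqr_nat algC) -sum1_card natr_sum big_refls sumr_const.
by rewrite card_rot.
Qed.

Lemma reflsJ x w : w \in W -> (x ^ w \in refls s t W)%g = (x \in refls s t W).
Proof. by move=> wW; rewrite !reflsE groupJr // conj_in_rot. Qed.

Lemma nfix_refls x : nfix x = \sum_(a in refls s t W) (a ^ x == a)%g%:R.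
Proof. by rewrite big_refls. Qed.

(** * Classes and centralizers of rotations *)

Lemma rot_class x : x \in rot -> (x^-1 ^: W = x ^: W)%g.
Proof. by move=> xr; rewrite -conj_rot_s // classGidl ?sW. Qed.

(** The class of [r ^+ j] consists of [r ^+ j] and [r ^+ (m - j)], and the two exponents lie on
    either side of [m / 2]. *)
Lemma rot_class_inj i j : (0 < i <= m./2)%N -> (0 < j <= m./2)%N ->
  ((r ^+ i) ^: W = (r ^+ j) ^: W)%g -> i = j.
Proof.
move=> im jm eqij.
have : (r ^+ i \in (r ^+ j) ^: W)%g by rewrite -eqij class_refl.
case/imsetP=> y; rewrite WE.
have inj a b : (a < m)%N -> (b < m)%N -> (r ^+ a = r ^+ b)%g -> a = b.
  by move=> am bm /eqP; rewrite eq_expg_mod_order or !modn_small // => /eqP.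
case/orP=> [yr|yr].
  by rewrite conj_rot_rot ?mem_cycle // => /inj -> //; lia.
rewrite -(mulsK y) conj_rot_refl ?mem_cycle // rot_expV; last lia.
by move/inj => ij; have := ij _ _; lia.
Qed.

(** A reflection inverts [r ^+ j], so it centralizes it only if [r ^+ j.*2 = 1], which the bounds on
    [j] exclude. *)
Lemma cent_small j : (0 < j)%N -> (j.*2 < m)%N -> 'C_W[r ^+ j]%g = rot.
Proof.
move=> j0 jm; apply/setP=> x; rewrite inE; apply/andP/idP=> [[xW]|xr]; last first.
  by split; [apply: rot_W | apply/cent1P; rewrite /commute (rot_comm xr) ?mem_cycle].
move/cent1P=> xC; apply: contraT => xr.
have [u ur xE] := reflP xW xr.
have : (r ^+ j ^ x)%g = (r ^+ j)%g by rewrite conjgE -xC mulKg.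
rewrite xE conj_rot_refl ?mem_cycle // => /eqP; rewrite eq_invg_mul -expgD addnn.
by rewrite -order_dvdn or gtnNdvd //; lia.
Qed.

Lemma cent_half j : j.*2 = m -> 'C_W[r ^+ j]%g = W.
Proof.
move=> jm; apply/setP=> x; rewrite inE; have [xW|//] := boolP (x \in W) => /=.
have jV : ((r ^+ j)^-1 = r ^+ j)%g by rewrite rot_expV; [congr (_ ^+ _)%g|]; lia.
apply/cent1P; rewrite /commute.
have [xr|xr] := boolP (x \in rot); first by rewrite (rot_comm xr) ?mem_cycle.
have [u ur ->] := reflP xW xr.
rewrite -(mulgA u s) (mul_s_rot (mem_cycle r j)) jV (mulgA u) (rot_comm ur (mem_cycle r j)).
by rewrite mulgA.
Qed.

(** * Linear characters of the centralizers and sums of induced characters *)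

Section Characters.

Variable z : algC.
Hypothesis zP : m.-primitive_root z.

Lemma chi_exp j k : chi s t m z j (r ^+ k)%g = z ^+ (j * k).
Proof.
rewrite /chi; case: pickP => [i /eqP/eqP|/(_ (Ordinal (ltn_pmod k (ltnW m_gt1))))] /=.
  rewrite eq_expg_mod_order or => /eqP ik.
  by rewrite !(mulnC j) !exprM -(prim_expr_mod zP i) ik (prim_expr_mod zP).
by rewrite -[X in (_ %% X)%N]or expg_mod_order eqxx.
Qed.

Lemma chi_M j : {in rot &, {morph chi s t m z j : x y / (x * y)%g >-> x * y}}.
Proof.
move=> x y /cycleP[a ->] /cycleP[b ->]; rewrite -expgD !chi_exp mulnDr.
by rewrite exprD.
Qed.

Lemma chi_1 j : chi s t m z j 1%g = 1.
Proof. by rewrite -(expg0 r) chi_exp muln0. Qed.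

Lemma sgn_1 : sgnS s t 1%g = 1.
Proof. by rewrite sgn_W ?group1. Qed.

Lemma sgn_J x y : x \in W -> y \in W -> sgnS s t (x ^ y)%g = sgnS s t x.
Proof. by move=> xW yW; rewrite !sgn_W ?(groupJ xW yW) // conj_in_rot. Qed.

Lemma phi_lin j : (0 < j <= m./2)%N ->
  phi s t m z j 1%g = 1 /\
  {in 'C_W[r ^+ j]%g &, {morph phi s t m z j : x y / (x * y)%g >-> x * y}}.
Proof.
move=> /andP[j0 jm]; have [j2|j2] := eqVneq j.*2 m.
  have mo : odd m = false by lia.
  split=> [|x y]; rewrite /phi mo j2 eqxx ?sgn_1 //.
  by rewrite cent_half // => xW yW; rewrite sgn_M.
have jm2 : (j.*2 < m)%N by lia.
rewrite cent_small // /phi (negbTE j2).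
by case: odd; split; rewrite ?chi_1 //; apply: chi_M.
Qed.

Lemma psi_lin j : (0 < j <= m./2)%N ->
  psi s t m z j 1%g = 1 /\
  {in 'C_W[r ^+ j]%g &, {morph psi s t m z j : x y / (x * y)%g >-> x * y}}.
Proof.
move=> jm; have [p1 pM] := phi_lin jm; rewrite /psi.
split=> [|x y xC yC]; first by rewrite p1 sgn_1 mulr1.
have CW u : u \in 'C_W[r ^+ j]%g -> u \in W by rewrite inE => /andP[].
by rewrite pM // sgn_M ?CW // mulrACA.
Qed.

(** The centralizer is [rot]. Elements of [rot] fix a rotation [x] and those of the other coset
    invert it; each coset contributes [m] equal terms, and [m] is the order of the centralizer. *)
Lemma Ind_small j (l : 'CF('C_W[r ^+ j]%G)) (F : gT -> algC) x :
    (0 < j)%N -> (j.*2 < m)%N -> {in 'C_W[r ^+ j]%g, l =1 F} -> x \in W ->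
  ('Ind[W] l) x = if x \in rot then F x + F x^-1%g else 0.
Proof.
move=> j0 jm lF xW; have CE := cent_small j0 jm.
have cardC : #|'C_W[r ^+ j]%G| = m by rewrite /= CE card_rot.
rewrite cfIndE ?subsetIl // cardC.
have [xr|xr] := boolP (x \in rot); last first.
  by rewrite big1 ?mulr0 // => y yW; rewrite cfun0 //= CE conj_in_rot.
rewrite big_W (eq_bigr (fun=> F x)) => [|y yr]; last by rewrite conj_rot_rot // lF ?CE.
rewrite [X in _ + X](eq_bigr (fun=> F x^-1%g)) => [|y yr]; last first.
  by rewrite conj_rot_refl // lF ?CE ?groupV.
by rewrite !sumr_const card_rot -mulrnDl -[(_ + _) *+ _]mulr_natl mulKf.
Qed.

Lemma Ind_half j (l : 'CF('C_W[r ^+ j]%G)) (F : gT -> algC) x :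
    j.*2 = m -> {in 'C_W[r ^+ j]%g, l =1 F} -> x \in W ->
    {in W &, forall u v, F (u ^ v)%g = F u} ->
  ('Ind[W] l) x = F x.
Proof.
move=> jm lF xW FJ; have CE := cent_half jm.
have cardC : #|'C_W[r ^+ j]%G| = #|W| by rewrite /= CE.
rewrite cfIndE ?subsetIl // cardC (eq_bigr (fun=> F x)) => [|y yW].
  by rewrite sumr_const -[F x *+ _]mulr_natl mulKf // card_W.
by rewrite lF ?CE ?groupJ // FJ.
Qed.

(** Applied with [d = 1], [n = m] for odd [m], and with [d = 2], [n = m./2] for even [m]. *)
Lemma sum_chi_rot n (d : nat) k : (0 < n)%N -> (d * n = m)%N ->
    \sum_(1 <= j < n) z ^+ (d * j * k) = n%:R * (m %| d * k)%N%:R - 1.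
Proof.
move=> n0 dn; under eq_bigr do rewrite mulnAC exprM.
rewrite sum_unity_root //; last by rewrite -exprM mulnAC dn exprM (prim_expr_order zP) expr1n.
by rewrite -(prim_order_dvd zP).
Qed.

(** The twist [c] is [1] for [Phi_S] and [sgnS] for [Psi_S], so one computation serves both. At a
    reflection only the class of the central involution, present for even [m], contributes. *)
Lemma sum_Ind (l : forall j : nat, 'CF('C_W[r ^+ j]%G)) (c : gT -> algC) x :
    (forall j, (0 < j <= m./2)%N ->
       {in 'C_W[r ^+ j]%g, forall u, l j u = phi s t m z j u * c u}) ->
    {in rot, forall u, c u = 1} -> {in W &, forall u v, c (u ^ v)%g = c u} ->
    x \in W ->
  \sum_(1 <= j < m./2.+1) ('Ind[W] (l j)) x =
    if x \in rot then m%:R * (x * x == 1)%g%:R - 1 else - (~~ odd m)%:R * c x.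
Proof.
move=> lE c1 cJ xW.
have IndS j : (0 < j)%N -> (j.*2 < m)%N -> ('Ind[W] (l j)) x =
    if x \in rot then phi s t m z j x + phi s t m z j x^-1%g else 0.
  move=> j0 jm; rewrite (Ind_small j0 jm (lE j _)) //; last lia.
  by case: ifP => // xr; rewrite !c1 ?groupV // !mulr1.
have IndH j : j.*2 = m -> ('Ind[W] (l j)) x = sgnS s t x * c x.
  move=> jm; have phE : phi s t m z j =1 sgnS s t.
    by move=> u; rewrite /phi jm eqxx ifF //; lia.
  rewrite (Ind_half jm (lE j _)) ?phE //; first lia.
  by move=> u v uW vW; rewrite !phE sgn_J // cJ.
have [xr|xr] := boolP (x \in rot); last first.
  have [mo|me] := boolP (odd m).
    rewrite oppr0 mul0r big_nat big1 // => j jm.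
    by rewrite IndS ?(negbTE xr) //; lia.
  rewrite big_nat_recr //=; last lia.
  rewrite IndH; last lia.
  rewrite big_nat big1 ?add0r => [|j jm]; first by rewrite sgn_W // xr.
  by rewrite IndS ?(negbTE xr) //; lia.
have [k] := cyclePmin xr; rewrite or => km xE.
have xVE : x^-1%g = (r ^+ (m - k))%g by rewrite xE rot_expV // ltnW.
have xxE : (x * x == 1)%g = (m %| 2 * k)%N.
  by rewrite xE -expgD addnn -order_dvdn or mul2n.
(* Both sides are inverse to [z ^+ (d * j * k)]. The value at [x^-1] for [j] thus becomes the value
   at [x] for [n - j]. *)
have zrev d n j : (d * n = m)%N -> (j <= n)%N ->
    z ^+ (d * j * (m - k)) = z ^+ (d * (n - j) * k).
  move=> dn jn.
  have z0 : z ^+ (d * j * k) != 0.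
    rewrite expf_neq0 //; apply/eqP=> z0; have /eqP := prim_expr_order zP.
    by rewrite z0 expr0n gtn_eqF ?(ltnW m_gt1) // eq_sym oner_eq0.
  apply: (mulIf z0); rewrite -!exprD -mulnDr -mulnDl -mulnDr !subnK ?(ltnW km) //.
  by rewrite dn mulnC !exprM (prim_expr_order zP) !expr1n.
rewrite xr in IndS; rewrite xxE; have [mo|me] := boolP (odd m).
  have phE j u : phi s t m z j u = chi s t m z j u by rewrite /phi mo.
  rewrite (eq_big_nat _ _ (F2 := fun j => z ^+ (1 * j * k) + z ^+ (1 * (m - j) * k))).
    rewrite big_split /= (@sum_nat_rev _ (fun i => z ^+ (1 * i * k))); last lia.
    have -> : (m - m./2 = m./2.+1)%N by lia.
    rewrite -big_cat_nat //=; last lia.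
    rewrite sum_chi_rot ?mul1n //; last lia.
    (* As [m] is odd, [m] divides [2 * k] exactly when it divides [k]. *)
    by rewrite Gauss_dvdr // coprimen2.
  move=> j jm; rewrite IndS; [|lia|lia].
  by rewrite !phE xVE xE !chi_exp -(zrev 1%N) ?mul1n //; lia.
have phE j u : (j.*2 < m)%N -> phi s t m z j u = chi s t m z j.*2 u.
  by move=> jm; rewrite /phi (negbTE me) ifF //; lia.
(* For even [m] the last term is the class of the involution and contributes [1]. The other terms
   run twice over [1 <= j < m./2], giving twice [sum_chi_rot], hence [- 2 + 1 = - 1] for the
   constant. *)
rewrite big_nat_recr /=; last lia.
rewrite IndH; last lia.
rewrite (eq_big_nat _ _ (F2 := fun j => z ^+ (2 * j * k) + z ^+ (2 * (m./2 - j) * k))).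
  have hE : (m./2 = m./2.-1.+1)%N by lia.
  rewrite big_split /= {2}hE (@sum_nat_rev _ (fun i => z ^+ (2 * i * k))); last lia.
  have -> : (m./2 - m./2.-1 = 1)%N by lia.
  rewrite !sum_chi_rot; try lia.
  rewrite sgn_W // xr c1 // expr0.
  have -> : m%:R = 2 * m./2%:R :> algC by rewrite -natrM; congr _%:R; lia.
  ring.
move=> j jm; rewrite IndS; [|lia|lia].
rewrite !phE; [|lia|lia].
by rewrite xVE xE !chi_exp -mul2n (zrev 2%N m./2) //; lia.
Qed.

End Characters.

(** * The reflection representation and its hyperplanes *)

Section Representation.

Variable rho : gT -> 'M[algC]_2.
Hypotheses (reprP : mx_repr W rho) (inj_rho : {in W &, injective rho}).
Hypotheses (rank_s : \rank (rho s - 1%:M) = 1%N) (rank_t : \rank (rho t - 1%:M) = 1%N).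

Let rho1 : rho 1%g = 1. Proof. by case: reprP. Qed.
Let rhoM : {in W &, forall x y, rho (x * y)%g = rho x *m rho y}.
Proof. by case: reprP. Qed.

Lemma rhoX x n : x \in W -> rho (x ^+ n)%g = rho x ^+ n.
Proof.
move=> xW; elim: n => [|n IHn]; first by rewrite expg0 rho1.
by rewrite expgS exprS rhoM ?groupX // IHn.
Qed.

Lemma det_eq0_rank (A : 'M[algC]_2) : (\det A == 0) = (\rank A != 2%N).
Proof. by rewrite -[_ != _]/(~~ row_free A) row_free_unit unitmxE unitfE negbK. Qed.

Lemma rho_eq1 x : x \in W -> rho x = 1 -> x = 1%g.
Proof. by move=> xW x1; apply: inj_rho; rewrite ?group1 ?rho1. Qed.

(** The determinant squares to [1]. If it were [1], the fixed vector given by the rank condition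
    would make [rho x] the identity. *)
Lemma det_invol x : x \in W -> (x * x = 1)%g -> \rank (rho x - 1%:M) = 1%N ->
  \det (rho x) = -1.
Proof.
move=> xW xx rk.
have xx1 : rho x ^+ 2 = 1 by rewrite -rhoX // expg2 xx rho1.
have /eqP : \det (rho x) ^+ 2 = 1.
  by rewrite expr2 -det_mulmx -[_ *m _]/(rho x ^+ 2) xx1 det1.
rewrite sqrf_eq1 => /orP[/eqP d1|/eqP//].
have x1 : rho x = 1.
  by apply: (finite_order_mx2 _ xx1 d1) => //; apply/eqP; rewrite det_eq0_rank rk.
by move: rk; rewrite x1 subrr mxrank0.
Qed.

Lemma det_rot x : x \in rot -> \det (rho x) = 1.
Proof.
case/cycleP=> k ->; rewrite rhoX ?rW //.
have dr : \det (rho r) = 1.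
  by rewrite rhoM ?sW ?tW // det_mulmx !det_invol ?sW ?tW // mulrNN mulr1.
elim: k => [|k IHk]; first by rewrite expr0 det1.
by rewrite exprS det_mulmx dr IHk mulr1.
Qed.

Lemma rot_fix x : x \in rot -> \det (rho x - 1%:M) = 0 -> x = 1%g.
Proof.
move=> xr dx; apply: rho_eq1; rewrite ?rot_W //.
apply: (finite_order_mx2 (ltnW m_gt1) _ (det_rot xr) dx).
by rewrite -rhoX ?rot_W // -card_rot expg_cardG // rho1.
Qed.

(** The hypotheses give a fixed line only for [s] and [t]. In general the determinant is [-1] and
    the square is [1], so Cayley-Hamilton forces trace [0], and [1] is an eigenvalue. *)
Lemma det_refl x : x \in refls s t W -> \det (rho x - 1%:M) = 0.
Proof.
rewrite reflsE => /andP[xW xr].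
have dx : \det (rho x) = -1.
  have [z zr ->] := reflP xW xr.
  by rewrite rhoM ?sW ?rot_W // det_mulmx det_rot // det_invol ?sW // mul1r.
have := sqr_mx2 (rho x); rewrite -rhoM // refl_invol // rho1 dx.
rewrite raddfN opprK -[X in X = _]add0r => /addIr/esym/eqP; rewrite scaler_eq0.
case/orP=> [/eqP tx|/eqP x0]; first by rewrite det_sub1_2 tx dx subr0 subrr.
by move: dx; rewrite x0 det0 => /eqP; rewrite eq_sym oppr_eq0 oner_eq0.
Qed.

Lemma rank_refl x : x \in refls s t W -> \rank (rho x - 1%:M) = 1%N.
Proof.
move=> xr; have := rank_leq_row (rho x - 1%:M).
have /eqP := det_refl xr; rewrite det_eq0_rank leq_eqVlt => /negPf-> /=.
rewrite ltnS leq_eqVlt ltnS leqn0 mxrank_eq0 subr_eq0 => /orP[/eqP//|/eqP x1].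
move: xr; rewrite reflsE => /andP[xW]; rewrite (rho_eq1 xW x1).
by rewrite group1.
Qed.

Lemma cuspidalE x : x \in W -> cuspidal rho x = (x \in rot) && (x != 1%g).
Proof.
move=> xW; rewrite /cuspidal mxrank_ker.
have -> : (2 - \rank (rho x - 1%:M)%R == 0)%N = (\det (rho x - 1%:M) != 0).
  by rewrite det_eq0_rank negbK subn_eq0 eqn_leq rank_leq_row.
have [xr|xr] := boolP (x \in rot); last first.
  by rewrite det_refl ?eqxx // reflsE xW.
apply/idP/idP=> /=; apply: contraNN => /eqP; last by move/(rot_fix xr)->.
by move=> ->; rewrite rho1 subrr det0.
Qed.

(** The product of two reflections is a rotation, trivial once it has a nonzero fixed vector. *)
Lemma refl_fix_eq x y : x \in refls s t W -> y \in refls s t W ->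
  \det (rho (x * y)%g - 1%:M) = 0 -> x = y.
Proof.
rewrite !reflsE => /andP[xW xr] /andP[yW yr] dxy.
have xyr : (x * y)%g \in rot.
  have [u ur ->] := reflP xW xr; have [v vr ->] := reflP yW yr.
  by rewrite (mul_rot_s vr) mulgA mulsK groupM ?groupV.
have /eqP := rot_fix xyr dxy; rewrite -eq_invg_mul => /eqP <-.
by rewrite refl_inv.
Qed.

(** A vector on a common hyperplane is fixed by both reflections, hence by their product. *)
Lemma hyp_inj : {in refls s t W &, injective (hyp rho)}.
Proof.
move=> x y xr yr /genmxP/andP[sxy _]; apply: refl_fix_eq => //.
have [xW yW] : x \in W /\ y \in W.
  by move: xr yr; rewrite !reflsE => /andP[-> _] /andP[-> _].
set K := kermx (rho x - 1%:M) in sxy.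
have K0 : K != 0 by rewrite -mxrank_eq0 mxrank_ker rank_refl.
have fixE u : (K <= kermx (rho u - 1%:M))%MS -> K *m rho u = K.
  by move/sub_kermxP/eqP; rewrite mulmxBr mulmx1 subr_eq0 => /eqP.
apply/eqP; apply: contraR K0; rewrite -unitfE -unitmxE => U.
rewrite -(mulmxK U K) mulmxBr mulmx1 rhoM // mulmxA !fixE //.
by rewrite subrr mul0mx.
Qed.

Lemma hdep2 x y : x \in refls s t W -> y \in refls s t W ->
  hdep rho [:: x; y] -> x = y.
Proof.
move=> xr yr; rewrite /hdep !big_cons big_nil addsmx0_id /= ltnS => rk.
have [xW yW] : x \in W /\ y \in W.
  by move: xr yr; rewrite !reflsE => /andP[-> _] /andP[-> _].
have : ((rho y - 1%:M)^T <= (rho x - 1%:M)^T)%MS.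
  have sum_sub : (<<(rho x - 1%:M)^T>> + <<(rho y - 1%:M)^T>>
      <= <<(rho x - 1%:M)^T>>)%MS.
    rewrite -(geq_leqif (mxrank_leqif_sup (addsmxSl _ _))).
    by rewrite genmxE mxrank_tr rank_refl.
  have := submx_trans (addsmxSr _ _) sum_sub.
  by rewrite !genmxE.
case/submxP=> D /(congr1 trmx); rewrite trmx_mul !trmxK => yE.
apply: refl_fix_eq => //; rewrite rhoM //.
(* Proportional linear forms make [rho y - 1] a right multiple of [rho x - 1]. Then [rho x - 1] also
   divides [rho (x * y) - 1], which is therefore singular. *)
have -> : rho x *m rho y - 1%:M = (rho x - 1%:M) *m (rho y + D^T).
  by rewrite mulmxDr -yE mulmxBl mul1mx addrA subrK.
by rewrite det_mulmx det_refl // mul0r.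
Qed.

Lemma hdep1 x : x \in refls s t W -> hdep rho [:: x] = false.
Proof.
by move=> xr; rewrite /hdep big_seq1 genmxE mxrank_tr rank_refl.
Qed.

Lemma hdep3 x y z : hdep rho [:: x; y; z].
Proof. exact: rank_leq_row. Qed.

Lemma hypJ x w : x \in refls s t W -> w \in W ->
  <<hyp rho x *m rho w>>%MS = hyp rho (x ^ w)%g.
Proof.
move=> xr wW; apply/genmxP.
have xW : x \in W by move: xr; rewrite reflsE => /andP[].
have wU : rho w \in unitmx.
  have : rho w *m rho w^-1%g = 1%:M by rewrite -rhoM ?groupV // mulgV rho1.
  by case/mulmx1_unit.
have rkK u : u \in refls s t W -> \rank (kermx (rho u - 1%:M)) = 1%N.
  by move=> ur; rewrite mxrank_ker rank_refl.
have sub : (hyp rho x *m rho w <= kermx (rho (x ^ w)%g - 1%:M))%MS.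
  apply/sub_kermxP; rewrite mulmxBr mulmx1 -mulmxA -rhoM ?groupJ //.
  have -> : (w * x ^ w)%g = (x * w)%g by rewrite conjgE mulKVg.
  rewrite rhoM // mulmxA -mulmxBl.
  have -> : hyp rho x *m rho x - hyp rho x = 0.
    rewrite -{2}[hyp rho x]mulmx1 -mulmxBr; apply/sub_kermxP; by rewrite genmxE.
  by rewrite mul0mx.
rewrite -(geq_leqif (mxrank_leqif_eq sub)).
by rewrite rkK ?reflsJ // mxrankMfree ?row_free_unit // genmxE rkK.
Qed.

Lemma piA_nfix w : w \in W -> piA s t W rho w = nfix w.
Proof.
move=> wW; rewrite /piA /hyps undup_id; last first.
  rewrite map_inj_in_uniq ?enum_uniq // => x y; rewrite !mem_enum.
  exact: hyp_inj.
rewrite count_map -sum1_count natr_sum nfix_refls -big_enum /= big_mkcond.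
rewrite [LHS]big_seq [RHS]big_seq; apply: eq_bigr => x; rewrite mem_enum => xr.
rewrite hypJ // (inj_in_eq hyp_inj) ?reflsJ //.
by case: eqP.
Qed.

(** * The degree two part of the Orlik-Solomon algebra *)

Local Notation T := (refls s t W).
Local Notation N := #|{: gT * gT}|.
Local Notation rel3 x y z := (wedge x z - wedge y z - wedge x y).

Lemma wedgeC (x y : gT) : wedge x y = - wedge y x.
Proof. by rewrite /wedge opprB. Qed.

Lemma Lam2_sub (M : 'M[algC]_N) k (B : 'M_(k, N)) :
    {in T &, forall x y, (wedge x y *m M <= B)%MS} ->
  (Lam2 s t W *m M <= B)%MS.
Proof.
move=> subB; rewrite /Lam2 sumsmxMr; apply/sumsmx_subP=> x xT.
rewrite sumsmxMr; apply/sumsmx_subP=> y yT.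
by rewrite (eqmxMr _ (genmxE _)) subB.
Qed.

Lemma wedge_Lam2 x y : x \in T -> y \in T -> (wedge x y <= Lam2 s t W)%MS.
Proof.
move=> xT yT; apply: (sumsmx_sup x) => //; apply: (sumsmx_sup y) => //.
by rewrite genmxE.
Qed.

(** By [hdep2] a dependent pair has equal members, so its relation vanishes, and by [hdep1] no
    single reflection is dependent. Only the relations of triples remain. *)
Lemma OSrel_sub (M : 'M[algC]_N) k (B : 'M_(k, N)) :
    {in T & &, forall x y z, (rel3 x y z *m M <= B)%MS} ->
  (OSrel s t W rho *m M <= B)%MS.
Proof.
move=> subB; rewrite /OSrel addsmxMr addsmx_sub addsmxMr addsmx_sub -andbA.
apply/and3P; split.
- rewrite sumsmxMr; apply/sumsmx_subP=> x xT.
  rewrite sumsmxMr; apply/sumsmx_subP=> y yT.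
  rewrite sumsmxMr; apply/sumsmx_subP=> z /andP[zT _].
  by rewrite (eqmxMr _ (genmxE _)) subB.
- rewrite sumsmxMr; apply/sumsmx_subP=> u uT.
  rewrite sumsmxMr; apply/sumsmx_subP=> x xT.
  rewrite sumsmxMr; apply/sumsmx_subP=> y /andP[yT /(hdep2 xT yT) ->].
  by rewrite (eqmxMr _ (genmxE _)) subrr mul0mx sub0mx.
rewrite sumsmxMr; apply/sumsmx_subP=> u uT.
rewrite sumsmxMr; apply/sumsmx_subP=> v vT.
by rewrite sumsmxMr; apply/sumsmx_subP=> x /andP[/hdep1->].
Qed.

Lemma rel3_OSrel x y z : x \in T -> y \in T -> z \in T ->
  (rel3 x y z <= OSrel s t W rho)%MS.
Proof.
move=> xT yT zT; rewrite /OSrel -addsmxA.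
apply: submx_trans (addsmxSl _ _).
apply: (sumsmx_sup x) => //; apply: (sumsmx_sup y) => //.
by apply: (sumsmx_sup z); rewrite ?zT ?hdep3 // genmxE.
Qed.

Lemma wedge_Rp (w x y : gT) : wedge x y *m Rp w = wedge (x ^ w)%g (y ^ w)%g.
Proof.
have pvecR p : pvec p *m Rp w = pvec (p.1 ^ w, p.2 ^ w)%g.
  apply/rowP=> j; rewrite -rowE !mxE eqxx enum_rankK.
  by rewrite -(inj_eq enum_val_inj) enum_rankK.
by rewrite mulmxBl !pvecR.
Qed.

(* Averaging [a_x a_y = a_z a_y - a_z a_x] over all reflections [z] gives a
   [W]-equivariant projection of the exterior square along the relations. *)
Definition wavg (x : gT) : 'rV[algC]_N := m%:R^-1 *: \sum_(z in T) wedge z x.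

(** A [wedge] is the difference of the basis vectors of two opposite pairs, which contribute
    equally; hence the factor [2^-1]. *)
Definition Lam2_proj : 'M[algC]_N :=
  \matrix_(i < N) (if ((enum_val i).1 \in T) && ((enum_val i).2 \in T)
                   then 2^-1 *: (wavg (enum_val i).2 - wavg (enum_val i).1) else 0).

Lemma wedge_proj x y : x \in T -> y \in T ->
  wedge x y *m Lam2_proj = wavg y - wavg x.
Proof.
move=> xT yT; rewrite mulmxBl -!rowE !rowK !enum_rankK /= xT yT /=.
rewrite -scalerBr opprB addrACA -opprD.
rewrite -[wavg y + wavg y]mulr2n -[wavg x + wavg x]mulr2n -mulrnBl -scaler_nat.
by rewrite scalerA mulVf ?scale1r // pnatr_eq0.
Qed.

Lemma wavg_proj x : x \in T ->
  wavg x *m Lam2_proj = wavg x - m%:R^-1 *: \sum_(z in T) wavg z.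
Proof.
move=> xT; rewrite -scalemxAl mulmx_suml.
rewrite (eq_bigr _ (fun z zT => wedge_proj zT xT)) sumrB scalerBr; congr (_ - _).
by rewrite sumr_const card_refls -scaler_nat scalerA mulVf // scale1r.
Qed.

Lemma wavgE u x y : x \in T -> y \in T ->
  wavg u 0 (enum_rank (x, y)) = m%:R^-1 * ((u == y)%:R - (u == x)%:R).
Proof.
move=> xT yT; rewrite mxE summxE; congr (_ * _).
rewrite (eq_bigr (fun z => (z == x)%:R * (u == y)%:R - (z == y)%:R * (u == x)%:R)).
  by rewrite sumrB !sum_deltaM xT yT !mul1r.
move=> z _; rewrite !mxE eqxx /= !(inj_eq enum_rank_inj) !xpair_eqE.
by rewrite -!natrM !mulnb !(eq_sym x) !(eq_sym y) [(u == x) && _]andbC.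
Qed.

(** The projection contributes [1 / m.*2] times four delta terms at each pair of reflections. Summed
    over all pairs, the two diagonal ones give [m * nfix w] each and the two mixed ones [- m]
    each. *)
Lemma Psi_nfix w : w \in W -> Psi_S s t W rho w = nfix w - 1.
Proof.
move=> wW; rewrite /Psi_S (@quot_trace_idem _ _ _ Lam2_proj).
- rewrite /mxtrace.
  pose G (p : gT * gT) : algC := ((p.1 \in T) && (p.2 \in T))%:R * ((m.*2)%:R^-1 *
     ((p.2 ^ w == p.2)%:R - (p.2 ^ w == p.1)%:R - (p.1 ^ w == p.2)%:R + (p.1 ^ w == p.1)%:R)%g).
  have wavgR u : u \in T -> wavg u *m Rp w = wavg (u ^ w)%g.
    move=> uT; rewrite -scalemxAl mulmx_suml; congr (_ *: _).
    under eq_bigr do rewrite wedge_Rp.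
    rewrite [RHS](reindex_inj (conjg_inj w)) /=.
    by apply: eq_bigl => z; rewrite reflsJ.
  have diagE p : (Lam2_proj *m Rp w) (enum_rank p) (enum_rank p) = G p.
    set i := enum_rank p.
    have -> : (Lam2_proj *m Rp w) i i = row i (Lam2_proj *m Rp w) 0 i by rewrite [RHS]mxE.
    rewrite row_mul rowK /G {}/i enum_rankK; case: p => x y /=.
    case: ifP => [/andP[xT yT]|_]; last by rewrite mul0mx mxE mul0r.
    rewrite -scalemxAl mulmxBl !wavgR // mul1r.
    rewrite mxE mxE [(- _ : 'rV_ _) _ _]mxE !wavgE // -mul2n natrM invfM -mulrA.
    ring.
  rewrite (eq_bigr (fun i => G (enum_val i))) => [|i _]; last by rewrite -diagE enum_valK.
  rewrite -(big_enum_val G) /=.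
  rewrite -(pair_bigA _ (fun x y => G (x, y))) /=.
  transitivity (\sum_(x in T) \sum_(y in T) ((m.*2)%:R^-1 *
     ((y ^ w == y)%:R - (y ^ w == x)%:R - (x ^ w == y)%:R + (x ^ w == x)%:R)%g : algC)).
    rewrite [RHS]big_mkcond; apply: eq_bigr => x _; rewrite /G /=.
    case: (x \in T); last by rewrite big1 // => y _; rewrite mul0r.
    rewrite [RHS]big_mkcond; apply: eq_bigr => y _.
    by case: (y \in T); rewrite ?mul1r // mul0r.
  under eq_bigr => x xT.
    rewrite -mulr_sumr !big_split /= !sumrN.
    have -> : \sum_(y in T) (x ^ w == y)%g%:R = 1 :> algC.
      by under eq_bigr do rewrite eq_sym; rewrite sum_delta reflsJ ?xT.
    have -> : \sum_(y in T) (y ^ w == x)%g%:R = 1 :> algC.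
      rewrite (eq_bigr (fun y => (y == x ^ w^-1)%g%:R)) ?sum_delta ?reflsJ ?xT ?groupV //.
      by move=> y _; rewrite -[in RHS](inj_eq (conjg_inj w)) conjgKV.
    rewrite -nfix_refls sumr_const card_refls.
    over.
  rewrite -mulr_sumr !big_split /= sumrMnl -nfix_refls !sumr_const card_refls.
  rewrite -(mulr_natr (nfix w)) -(mulr_natr (-1)) -mul2n natrM; field; exact: mR_neq0.
- rewrite -[OSrel _ _ _ _]mulmx1; apply: OSrel_sub => x y z xT yT zT.
  rewrite mulmx1; apply: submx_subr; last exact: wedge_Lam2.
  by apply: submx_subr; apply: wedge_Lam2.
- apply: OSrel_sub => x y z xT yT zT.
  by rewrite mulmxBl mulmxBl !wedge_Rp rel3_OSrel ?reflsJ.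
- apply: Lam2_sub => x y xT yT.
  by rewrite wedge_Rp wedge_Lam2 ?reflsJ.
- apply/row_subP=> i; rewrite rowK; case: ifP => [/andP[xT yT]|_]; last exact: sub0mx.
  have wavg_sub u : u \in T -> (wavg u <= Lam2 s t W)%MS.
    move=> uT; apply/scalemx_sub/summx_sub => z zT.
    exact: wedge_Lam2.
  by apply/scalemx_sub/submx_subr; apply: wavg_sub.
(* The images [wavg y - wavg x] are differences, so they telescope around a triple. *)
- apply/eqP; rewrite -submx0; apply: OSrel_sub => x y z xT yT zT.
  rewrite mulmxBl mulmxBl !wedge_proj // !opprB (addrC (wavg z - _)).
  by rewrite (addrA _ (wavg z)) subrK (addrA _ (wavg x)) subrK subrr sub0mx.
- apply: Lam2_sub => x y xT yT; rewrite mulmxBr mulmx1 wedge_proj //.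
  (* The error of the projection is, up to sign, the average over [z] of the relations of the
     triples [x], [y], [z]. *)
  have -> : wedge x y - (wavg y - wavg x) =
      - (m%:R^-1 *: \sum_(z in T) rel3 x y z).
    have wE : wedge x y = m%:R^-1 *: \sum_(z in T) wedge x y.
      by rewrite sumr_const card_refls -scaler_nat scalerA mulVf // scale1r.
    rewrite {1}wE /wavg -!scalerBr -scalerN -!sumrB -sumrN; congr (_ *: _).
    apply: eq_bigr => z _; rewrite (wedgeC z x) (wedgeC z y).
    by rewrite opprK [RHS]opprB (addrC (- wedge y z)).
  rewrite eqmx_opp; apply/scalemx_sub/summx_sub => z zT.
  exact: rel3_OSrel.
(* The correction term in [wavg_proj] does not depend on [x], so it cancels in differences. *)
apply/row_matrixP=> i; rewrite row_mul !rowK.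
case: ifP => [/andP[xT yT]|_]; last by rewrite mul0mx.
by rewrite -scalemxAl mulmxBl !wavg_proj // opprB addrA subrK.
Qed.

Lemma Psi_Phi x : x \in W -> Psi_S s t W rho x = Phi_S s t W x * sgnS s t x.
Proof.
move=> xW; rewrite Psi_nfix // sgn_W //; have [xr|xr] := boolP (x \in rot).
  by rewrite nfix_rot // Phi_rot // expr0 mulr1.
by rewrite nfix_refl // Phi_refl //; case: odd; rewrite /= expr1; ring.
Qed.

(** * Representatives of the cuspidal classes *)

Lemma cuspidal_classes :
  [set x ^: W | x in W & cuspidal rho x]%g
    = [set (r ^+ j) ^: W | j : 'I_(m./2).+1 & (0 < j)%N]%g.
Proof.
apply/setP=> A; apply/imsetP/imsetP=> [[x]|[j]].
  rewrite inE => /andP[xW]; rewrite cuspidalE // => /andP[/cyclePmin[k]].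
  rewrite or => km ->; have [->|k0 _ ->] := posnP k; first by rewrite expg0 eqxx.
  have [kh|kh] := leqP k m./2.
    by exists (inord k); rewrite ?inE inordK.
  (* An exponent beyond [m./2] is replaced by that of the inverse, which is conjugate. *)
  have mk : (m - k < m./2.+1)%N by lia.
  exists (inord (m - k)); first by rewrite inE inordK //; lia.
  by rewrite inordK // -rot_expV ?(ltnW km) // rot_class ?mem_cycle.
rewrite inE => j0 ->; exists (r ^+ j)%g => //.
have rjW : (r ^+ j)%g \in W by rewrite groupX ?rW.
rewrite inE rjW cuspidalE // mem_cycle /= -order_dvdn or.
apply/negP=> /(dvdn_leq j0); have := ltn_ord j; lia.
Qed.

End Representation.

End Dihedral.

Theorem theorem5p11 (gT : finGroupType) (W : {group gT}) (s t : gT) (m : nat)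
    (rho : gT -> 'M[algC]_2) (z : algC) :
  (2 <= m)%N -> #[s]%g = 2%N -> #[t]%g = 2%N -> #[(s * t)%g]%g = m ->
  W :=: <<[set s; t]>>%g ->
  mx_repr W rho -> {in W &, injective rho} ->
  \rank (rho s - 1%:M) = 1%N -> \rank (rho t - 1%:M) = 1%N ->
  m.-primitive_root z ->
  let w0 := longest s t W in
  [/\ {in W, forall x, Phi_S s t W x = ('Ind[W, <[w0]>%G] 1 - 1) x},
      {in W, forall x, Psi_S s t W rho x = piA s t W rho x - 1
                       /\ Psi_S s t W rho x = Phi_S s t W x * sgnS s t x},
      [set x ^: W | x in W & cuspidal rho x]%g
        = [set ((s * t) ^+ j) ^: W | j : 'I_(m./2).+1 & (0 < j)%N]%g,
      (forall i j : nat, (0 < i <= m./2)%N -> (0 < j <= m./2)%N ->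
         ((s * t) ^+ i) ^: W = ((s * t) ^+ j) ^: W -> i = j)%g
    & exists (lam mu : forall j : nat, 'CF(('C_W[(s * t) ^+ j])%G)),
      [/\ forall j : nat, (0 < j <= m./2)%N ->
            [/\ lam j \is a linear_char, mu j \is a linear_char,
                {in ('C_W[(s * t) ^+ j])%g, forall x, lam j x = phi s t m z j x}
              & {in ('C_W[(s * t) ^+ j])%g, forall x, mu j x = psi s t m z j x}],
          {in W, forall x, Phi_S s t W x = \sum_(1 <= j < (m./2).+1) ('Ind[W] (lam j)) x}
        & {in W, forall x, Psi_S s t W rho x = \sum_(1 <= j < (m./2).+1) ('Ind[W] (mu j)) x}]].
Proof.
move=> m2 os ot or defW reprP injr rks rkt zP w0.
have w0E : w0 = alt s t m by exact: longest_alt m2 os ot or defW.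
pose C j := ('C_W[(s * t) ^+ j])%G.
pose lam j := lin_of (C j) (phi s t m z j).
pose mu j := lin_of (C j) (psi s t m z j).
have lamP j : (0 < j <= m./2)%N ->
    lam j \is a linear_char /\ {in C j, lam j =1 phi s t m z j}.
  by move=> /(phi_lin m2 os ot or defW zP)[phi1 phiM]; apply: lin_ofP.
have muP j : (0 < j <= m./2)%N ->
    mu j \is a linear_char /\ {in C j, mu j =1 psi s t m z j}.
  by move=> /(psi_lin m2 os ot or defW zP)[psi1 psiM]; apply: lin_ofP.
split.
- by move=> x xW; rewrite w0E; apply: Phi_Ind.
- move=> x xW; split; last exact: (Psi_Phi m2 os ot or defW reprP injr rks rkt).
  rewrite (Psi_nfix m2 os ot or defW reprP injr rks rkt xW).
  by rewrite (piA_nfix m2 os ot or defW reprP injr rks rkt xW).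
- exact: cuspidal_classes.
- exact: rot_class_inj.
exists lam, mu; split=> [j jm|x xW|x xW].
- have [lam_lin lamE] := lamP j jm; have [mu_lin muE] := muP j jm.
  by split.
- rewrite (sum_Ind m2 os ot or defW zP (c := fun=> 1)) //.
    case: ifP => xr; first exact: Phi_rot.
    rewrite (Phi_refl m2 os ot or defW xW (negbT xr)) mulr1.
    by case: odd => /=; ring.
  by move=> j jm u uC; rewrite mulr1 (lamP j jm).2.
rewrite (sum_Ind m2 os ot or defW zP (c := sgnS s t)) //.
- rewrite (Psi_Phi m2 os ot or defW reprP injr rks rkt xW).
  rewrite (sgn_W m2 os ot or defW xW).
  case: ifP => xr; first by rewrite (Phi_rot m2 os ot or defW xr) mulr1.
  rewrite (Phi_refl m2 os ot or defW xW (negbT xr)) xr.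
  by case: odd => /=; ring.
- by move=> j jm u uC; rewrite (muP j jm).2.
- by move=> u ur; rewrite (sgn_W m2 os ot or defW) ?ur // (rot_W defW).
- by move=> u v uW vW; rewrite (sgn_J m2 os ot or defW).
Qed.
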